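(* Let $H$ be a separable infinite-dimensional complex Hilbert space and let $\mathcal{G}_{\infty}(H)$ be the set of all closed subspaces of $H$ whose dimension and codimension are both infinite. Let $f:\mathcal{G}_{\infty}(H)\to\mathcal{G}_{\infty}(H)$ be a (not necessarily surjective) map sending every pair of subspaces to an equivalent pair of subspaces. Suppose that for some $X\in\mathcal{G}_{\infty}(H)$ we have $f(\mathcal{G}^1(X))=\mathcal{G}^1(f(X))$. Then $f$ is induced by a linear or conjugate linear isometry of $H$, i.e. there is a linear or conjugate linear isometry $L:H\to H$ with $f(Y)=L(Y)$ for all $Y\in\mathcal{G}_{\infty}(H)$.
   Context: For a closed subspace $X$, $\mathcal{G}^1(X)$ denotes the set of all closed hyperplanes of $X$ (closed subspaces of codimension $1$ in $X$). A linear (conjugate linear) isometry $H\to H$ is a norm-preserving linear (conjugate linear) map, not necessarily surjective. Two pairs of closed subspaces are equivalent if some linear isometry of $H$ transfers one pair (as an unordered pair) to the other; thus $f$ sends every pair to an equivalent pair if for all $X,Y$ there is a linear isometry $M$ with $\{f(X),f(Y)\}=\{M(X),M(Y)\}$. *)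

(* Defs.v *)
From HB Require Import structures.
From mathcomp Require Import all_boot all_order all_algebra complex.
From mathcomp Require Import boolp classical_sets reals.
Set Implicit Arguments. Unset Strict Implicit. Unset Printing Implicit Defensive.
Import Order.TTheory GRing.Theory Num.Theory.
Local Open Scope ring_scope.
Local Open Scope classical_set_scope.

Section Hilbert.
Variables (R : realType) (H : lmodType R[i]) (ip : H -> H -> R[i]).

Definition inner_product : Prop :=
  [/\ forall (a : R[i]) (x y z : H), ip (a *: x + y) z = a * ip x z + ip y z,
      forall x y : H, ip y x = (ip x y)^*,
      forall x : H, 0 <= ip x x
    & forall x : H, ip x x = 0 -> x = 0].

Definition hnorm (x : H) : R := Num.sqrt (complex.Re (ip x x)).

Definition hcvg (u : nat -> H) (l : H) : Prop :=
  forall e : R, 0 < e -> exists N : nat, forall n, (N <= n)%N -> hnorm (u n - l) < e.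

Definition hcauchy (u : nat -> H) : Prop :=
  forall e : R, 0 < e -> exists N : nat, forall n m, (N <= n)%N -> (N <= m)%N ->
    hnorm (u n - u m) < e.

Definition hcomplete : Prop := forall u, hcauchy u -> exists l, hcvg u l.

Definition hseparable : Prop :=
  exists d : nat -> H, forall (x : H) (e : R), 0 < e -> exists n, hnorm (x - d n) < e.

Definition hilbert_space : Prop := inner_product /\ hcomplete.

Definition lin_subspace (X : set H) : Prop :=
  X 0 /\ forall (a : R[i]) (x y : H), X x -> X y -> X (a *: x + y).

Definition hclosed (X : set H) : Prop :=
  forall (u : nat -> H) (l : H), (forall n, X (u n)) -> hcvg u l -> X l.

Definition closed_subspace (X : set H) : Prop := lin_subspace X /\ hclosed X.

Definition lin_indep (n : nat) (v : 'I_n -> H) : Prop :=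
  forall c : 'I_n -> R[i], \sum_(i < n) c i *: v i = 0 -> forall i, c i = 0.

Definition infinite_dim (X : set H) : Prop :=
  forall n : nat, exists v : 'I_n -> H, (forall i, X (v i)) /\ lin_indep v.

Definition ortho (X : set H) : set H := [set y | forall x, X x -> ip x y = 0].

(* G_infty(H): closed subspaces of infinite dimension and infinite codimension
   (the codimension of a closed subspace is the dimension of its orthogonal
   complement) *)
Definition Ginf (X : set H) : Prop :=
  [/\ closed_subspace X, infinite_dim X & infinite_dim (ortho X)].

Definition hyperplanes (X : set H) : set (set H) :=
  [set Y | [/\ closed_subspace Y, Y `<=` X &
     exists v, [/\ X v, ~ Y v &
       forall x, X x -> exists (a : R[i]) (y : H), Y y /\ x = a *: v + y]]].

Definition lin_isometry (L : H -> H) : Prop :=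
  [/\ forall x y, L (x + y) = L x + L y,
      forall (a : R[i]) x, L (a *: x) = a *: L x
    & forall x, hnorm (L x) = hnorm x].

Definition conjlin_isometry (L : H -> H) : Prop :=
  [/\ forall x y, L (x + y) = L x + L y,
      forall (a : R[i]) x, L (a *: x) = a^* *: L x
    & forall x, hnorm (L x) = hnorm x].

Definition equiv_pairs (X1 Y1 X2 Y2 : set H) : Prop :=
  exists M : H -> H, lin_isometry M /\
    ((X2 = M @` X1 /\ Y2 = M @` Y1) \/ (X2 = M @` Y1 /\ Y2 = M @` X1)).

End Hilbert.

(* Main.v *)
(* All invariants of a pair (X, Y) (comparability, angles between hyperplanes) pass to
   (f X, f Y). Since f maps the hyperplanes of X0 onto those of f X0 preserving
   the angles of their normals, Wigner's theorem gives a linear or conjugate-linear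
   isometry U on X0 inducing f on hyperplanes of X0, hence on everything below X0
   (a closed subspace is an intersection of hyperplanes).
   For T in X0 of infinite codimension in X0, f (T + v) = f T + v' defines an
   angle-preserving map of the lines of T^perp; Wigner again, glued with U along
   T^perp inside X0, gives an isometry L of the whole of H with
   f (T' + v) = L (T' + v) for all T' below T: T is a base.
   If Y meets a base T in infinite dimension, then L Y is contained in f Y and
   L (Y^perp) is orthogonal to f Y, so f Y = L Y + N with N orthogonal to L H.
   To kill N, compare Y with Y2 = span (y_n + (n+1) u_n), y_n an orthonormal
   basis of Y and u_n orthonormal in Y^perp: P_Y P_Y2 P_Y has simple eigenvalues
   with total eigenvectors, its copy on f Y already contains L of all of them,
   and no room is left for N. This needs Y2 to meet T, hence Y^perp to meet T in
   infinite dimension. A subspace T1 such that T1 and T1^perp both meet the base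
   T is again a base, and any Y is reached in this way by a suitable T1. *)

Require Import Defs.
From HB Require Import structures.
From mathcomp Require Import all_boot all_order all_algebra complex.
From mathcomp Require Import boolp classical_sets reals.
From mathcomp Require Import ring lra zify.
Set Implicit Arguments. Unset Strict Implicit. Unset Printing Implicit Defensive.
Import Order.TTheory GRing.Theory Num.Theory.
Local Open Scope ring_scope.
Local Open Scope classical_set_scope.
Local Notation ortho := Defs.ortho.

(** * Inner products and Wigner's theorem *)

Section InnerProduct.
Variables (C : numClosedFieldType) (V : lmodType C) (ip : V -> V -> C).

(* [inner_product] over an arbitrary numClosedFieldType. *)
Definition ip_axioms : Prop :=
  [/\ forall (a : C) (x y z : V), ip (a *: x + y) z = a * ip x z + ip y z,
      forall x y : V, ip y x = (ip x y)^*,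
      forall x : V, 0 <= ip x x
    & forall x : V, ip x x = 0 -> x = 0].

Definition subsp (X : set V) : Prop :=
  X 0 /\ forall (a : C) (x y : V), X x -> X y -> X (a *: x + y).

(* [b = false] is the linear case, [b = true] the conjugate-linear one. *)
Definition sg (b : bool) (a : C) : C := if b then a^* else a.

(** The conditions are relative to [W] because Wigner's theorem controls a map only on the subspace
    where it is applied, first [X0], then an orthogonal complement. *)
Definition siso (b : bool) (W : set V) (L : V -> V) : Prop :=
  [/\ forall x y, W x -> W y -> L (x + y) = L x + L y,
      forall a x, W x -> L (a *: x) = sg b a *: L x
    & forall x y, W x -> W y -> ip (L x) (L y) = sg b (ip x y)].

Hypothesis hip : ip_axioms.

Lemma conjD (a b : C) : (a + b)^* = a^* + b^*. Proof. exact: rmorphD. Qed.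
Lemma conjM (a b : C) : (a * b)^* = a^* * b^*. Proof. exact: rmorphM. Qed.
Lemma conjN (a : C) : (- a)^* = - a^*. Proof. exact: rmorphN. Qed.
Lemma conjV (a : C) : (a^-1)^* = (a^*)^-1. Proof. exact: fmorphV. Qed.

Lemma ipC x y : ip y x = (ip x y)^*. Proof. by case: hip. Qed.
Lemma ip_ge0 x : 0 <= ip x x. Proof. by case: hip. Qed.
Lemma ip_eq0 x : ip x x = 0 -> x = 0. Proof. by case: hip => _ _ _; apply. Qed.

Lemma ipDl x y z : ip (x + y) z = ip x z + ip y z.
Proof. by case: hip => h _ _ _; rewrite -[x]scale1r h mul1r scale1r. Qed.
Lemma ip0l z : ip 0 z = 0.
Proof. by apply: (addrI (ip 0 z)); rewrite -ipDl !addr0. Qed.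
Lemma ipZl a x z : ip (a *: x) z = a * ip x z.
Proof. by case: hip => h _ _ _; rewrite -[a *: x]addr0 h ip0l addr0. Qed.
Lemma ipNl x z : ip (- x) z = - ip x z.
Proof. by rewrite -scaleN1r ipZl mulN1r. Qed.
Lemma ipBl x y z : ip (x - y) z = ip x z - ip y z.
Proof. by rewrite ipDl ipNl. Qed.
Lemma ipDr x y z : ip z (x + y) = ip z x + ip z y.
Proof. by rewrite !(ipC _ z) ipDl rmorphD. Qed.
Lemma ip0r z : ip z 0 = 0.
Proof. by rewrite ipC ip0l rmorph0. Qed.
Lemma ipZr a x z : ip z (a *: x) = a^* * ip z x.
Proof. by rewrite !(ipC _ z) ipZl rmorphM. Qed.
Lemma ipNr x z : ip z (- x) = - ip z x.
Proof. by rewrite !(ipC _ z) ipNl rmorphN. Qed.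
Lemma ipBr x y z : ip z (x - y) = ip z x - ip z y.
Proof. by rewrite ipDr ipNr. Qed.

Definition ipE := (ipDl, ipDr, ipNl, ipNr, ipZl, ipZr, ip0l, ip0r).

Lemma ip_conj x : (ip x x)^* = ip x x.
Proof. by rewrite -ipC. Qed.

Lemma ip_neq0 x : x <> 0 -> ip x x != 0.
Proof. by move=> nx; apply/eqP => /ip_eq0. Qed.

Lemma unit_neq0 x : ip x x = 1 -> x <> 0.
Proof. by move=> x1 x0; move/eqP: x1; rewrite x0 ip0l eq_sym oner_eq0. Qed.

Lemma ip_gt0 x : x <> 0 -> 0 < ip x x.
Proof. by move=> /ip_neq0 h; rewrite lt_def h ip_ge0. Qed.

Lemma ipC0 x y : ip x y = 0 -> ip y x = 0.
Proof. by move=> h; rewrite ipC h rmorph0. Qed.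

Lemma norm2_ip x y : `|ip x y| ^+ 2 = ip x y * ip y x.
Proof. by rewrite normCK (ipC x y). Qed.

(* The Gram-Schmidt vector whose norm gives both Cauchy-Schwarz and its equality case. *)
Lemma cs_defect x y (d := ip y y *: x - ip x y *: y) :
  ip d d = ip y y * (ip x x * ip y y - `|ip x y| ^+ 2).
Proof.
rewrite norm2_ip /d !ipE (ip_conj y) -(ipC x y); ring.
Qed.

Lemma cauchy_schwarz x y : `|ip x y| ^+ 2 <= ip x x * ip y y.
Proof.
have [->|ny] := pselect (y = 0); first by rewrite !ipE normr0 expr0n /= mulr0.
have := ip_ge0 (ip y y *: x - ip x y *: y).
by rewrite cs_defect pmulr_rge0 ?ip_gt0 // subr_ge0.
Qed.

Lemma cauchy_schwarz_eq x y : y <> 0 -> `|ip x y| ^+ 2 = ip x x * ip y y ->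
  x = (ip x y / ip y y) *: y.
Proof.
move=> ny e; have := cs_defect x y.
rewrite e subrr mulr0 => /ip_eq0 /subr0_eq h.
have n0 := ip_neq0 ny.
by rewrite mulrC -scalerA -h scalerA mulVf // scale1r.
Qed.

Lemma subspZ X a x : subsp X -> X x -> X (a *: x).
Proof. by move=> [X0 h] Xx; rewrite -[_ *: _]addr0; apply: h. Qed.
Lemma subspD X x y : subsp X -> X x -> X y -> X (x + y).
Proof. by move=> [X0 h] Xx Xy; rewrite -[x]scale1r; apply: h. Qed.
Lemma subspN X x : subsp X -> X x -> X (- x).
Proof. by move=> sX Xx; rewrite -scaleN1r; apply: subspZ. Qed.
Lemma subspB X x y : subsp X -> X x -> X y -> X (x - y).
Proof. by move=> sX Xx Xy; apply: subspD => //; apply: subspN. Qed.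

Lemma sgD b x y : sg b (x + y) = sg b x + sg b y.
Proof. by case: b => //=; rewrite rmorphD. Qed.
Lemma sgM b x y : sg b (x * y) = sg b x * sg b y.
Proof. by case: b => //=; rewrite rmorphM. Qed.
Lemma sg0 b : sg b 0 = 0.
Proof. by case: b => //=; rewrite rmorph0. Qed.
Lemma sg1 b : sg b 1 = 1.
Proof. by case: b => //=; rewrite rmorph1. Qed.
Lemma sgN b x : sg b (- x) = - sg b x.
Proof. by case: b => //=; rewrite rmorphN. Qed.
Lemma sgK b : involutive (sg b).
Proof. by case: b => x //=; rewrite conjCK. Qed.
Lemma sgJ b x : sg b x^* = (sg b x)^*.
Proof. by case: b. Qed.
Lemma sg_real b x : x^* = x -> sg b x = x.
Proof. by case: b. Qed.

Lemma norm_sqr_eq (a b : C) : `|a| = `|b| -> a * a^* = b * b^*.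
Proof. by rewrite -!normCK => ->. Qed.

Lemma prop_sym (x y : V) a : x <> 0 -> x = a *: y -> y = a^-1 *: x.
Proof.
move=> nx e; have na : a != 0 by apply/eqP => a0; apply: nx; rewrite e a0 scale0r.
by rewrite e scalerA mulVf // scale1r.
Qed.

(** * Wigner's theorem on a subspace *)

Section Wigner.
Variables (W : set V) (phi : V -> V).
Hypothesis subW : subsp W.
Hypothesis phiP : forall x y, W x -> W y -> `|ip (phi x) (phi y)| = `|ip x y|.

Lemma wigner_norm x : W x -> ip (phi x) (phi x) = ip x x.
Proof.
by move=> Wx; have := phiP Wx Wx; rewrite !ger0_norm // ip_ge0.
Qed.

(** Collinearity is the equality case of Cauchy-Schwarz, and [phi] preserves both sides of it. *)
Lemma wigner_prop x y a : W x -> W y -> x = a *: y -> exists c, phi x = c *: phi y.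
Proof.
move=> Wx Wy e.
have [y0|ny] := pselect (phi y = 0).
  have/ip_eq0 y00 : ip y y = 0 by rewrite -wigner_norm // y0 ip0l.
  exists 0; rewrite scale0r; apply: ip_eq0.
  by rewrite wigner_norm // e y00 scaler0 ip0l.
exists (ip (phi x) (phi y) / ip (phi y) (phi y)).
apply: cauchy_schwarz_eq => //.
rewrite phiP // !wigner_norm // normCK e !ipE conjM (ip_conj y); ring.
Qed.

(* Fix [e]; phases are normalised so that [phi (e + x)] is proportional to
   [e' + tau x], for x orthogonal to e. Then |n + <tau x, tau y>| = |n + <x, y>|
   and |<tau x, tau y>| = |<x, y>| force Re <tau x, tau y> = Re <x, y>, so tau is
   real-linear and tau (i x) = +-i tau x. *)
Section Basepoint.
Variable e : V.
Hypotheses (We : W e) (ne : e <> 0).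
Let n := ip e e.
Let e' := phi e.
Let E : set V := [set x | W x /\ ip x e = 0].

Lemma wigner_n : n != 0. Proof. exact: ip_neq0. Qed.
Lemma wigner_nC : n^* = n. Proof. exact: ip_conj. Qed.

Lemma wigner_subE : subsp E.
Proof.
split; first by split; [case: subW|rewrite ip0l].
move=> a x y [Wx xe] [Wy ye]; split; first by case: subW => _; apply.
by rewrite !ipE xe ye mulr0 addr0.
Qed.

(** [k x] is the coordinate of [phi (e + x)] along [e'], of modulus one because [e + x] has
    coordinate 1 along [e]. Dividing by it leaves [e'] plus a vector orthogonal to [e'], namely
    [tau x]. *)
Lemma wigner_tau_exists : exists k : V -> C, exists tau : V -> V, forall x, E x ->
  [/\ phi (e + x) = k x *: (e' + tau x), k x * (k x)^* = 1 & ip (tau x) e' = 0].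
Proof.
pose k x := ip (phi (e + x)) e' / n; have n0 := wigner_n.
exists k, (fun x => (k x)^-1 *: phi (e + x) - e') => x [Wx xe].
have Wex : W (e + x) by apply: subspD.
have k1 : k x * (k x)^* = 1.
  have := norm_sqr_eq (phiP Wex We).
  rewrite !ipE xe addr0 -/n -/e' wigner_nC => h.
  rewrite /k conjM conjV wigner_nC.
  by rewrite mulrACA h -invfM mulfV // mulf_neq0.
have kn : k x != 0.
  by apply/eqP => k0; move/eqP: k1; rewrite k0 mul0r eq_sym oner_eq0.
split=> //; first by rewrite (addrC e') subrK scalerA mulfV // scale1r.
rewrite ipBl ipZl wigner_norm // -/n.
have -> : ip (phi (e + x)) e' = k x * n by rewrite /k divfK.
by rewrite mulrA mulVf // mul1r subrr.
Qed.

Variables (k : V -> C) (tau : V -> V).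
Hypothesis tauP : forall x, E x ->
  [/\ phi (e + x) = k x *: (e' + tau x), k x * (k x)^* = 1 & ip (tau x) e' = 0].

Lemma wigner_phi x : E x -> phi (e + x) = k x *: (e' + tau x).
Proof. by case/tauP. Qed.

Lemma wigner_k x : E x -> k x * (k x)^* = 1.
Proof. by case/tauP. Qed.

Lemma wigner_kn x : E x -> k x != 0.
Proof.
move=> /wigner_k h; apply/eqP => k0; move/eqP: h.
by rewrite k0 mul0r eq_sym oner_eq0.
Qed.

Lemma wigner_tau_e x : E x -> ip (tau x) e' = 0.
Proof. by case/tauP. Qed.

Lemma wigner_e_tau x : E x -> ip e' (tau x) = 0.
Proof. by move/wigner_tau_e/ipC0. Qed.

Lemma wigner_sum x y : E x -> E y ->
  (n + ip (tau x) (tau y)) * (n + ip (tau x) (tau y))^*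
  = (n + ip x y) * (n + ip x y)^*.
Proof.
move=> Ex Ey; have [Wx xe] := Ex; have [Wy ye] := Ey.
have Wex : W (e + x) by apply: subspD.
have Wey : W (e + y) by apply: subspD.
have := norm_sqr_eq (phiP Wex Wey).
rewrite !wigner_phi // !ipE xe (ipC0 ye) wigner_tau_e // wigner_e_tau //.
rewrite wigner_norm // -/n !addr0 !add0r => <-.
set q := n + _.
rewrite -mulrDr -/q !conjM conjCK.
have hx := wigner_k Ex; have hy := wigner_k Ey.
transitivity ((k x * (k x)^*) * (k y * (k y)^*) * (q * q^*)); last by ring.
by rewrite hx hy !mul1r.
Qed.

Lemma wigner_nt x : E x -> ip (tau x) (tau x) = ip x x.
Proof.
move=> Ex; have [Wx xe] := Ex.
have Wex : W (e + x) by apply: subspD.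
have := wigner_norm Wex.
rewrite wigner_phi // !ipE xe (ipC0 xe) wigner_tau_e // wigner_e_tau //.
by rewrite wigner_norm // -/n !addr0 !add0r -mulrDr mulrA wigner_k // mul1r => /addrI.
Qed.

(** Since [phi y] is orthogonal to [e'], its inner product with [phi (e + y)] sees only [tau y]; its
    modulus is [ip y y], which is equality in Cauchy-Schwarz. *)
Lemma wigner_tau_phi y : E y -> exists c, tau y = c *: phi y.
Proof.
move=> Ey; have [Wy ye] := Ey.
have Wey : W (e + y) by apply: subspD.
have [y0|ny] := pselect (phi y = 0).
  exists 0; rewrite scale0r; apply: ip_eq0.
  by rewrite wigner_nt // -wigner_norm // y0 ip0l.
have eo : ip e' (phi y) = 0.
  have /eqP := phiP We Wy; rewrite (ipC0 ye) normr0 normr_eq0 => /eqP; exact.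
exists (ip (tau y) (phi y) / ip (phi y) (phi y)).
apply: cauchy_schwarz_eq => //.
have := norm_sqr_eq (phiP Wey Wy).
rewrite wigner_phi // !ipE (ipC0 ye) eo !add0r.
rewrite wigner_norm // wigner_nt // normCK (ip_conj y) => <-.
by rewrite conjM mulrACA wigner_k // mul1r.
Qed.

Lemma wigner_abs x y : E x -> E y ->
  ip (tau x) (tau y) * ip (tau y) (tau x) = ip x y * ip y x.
Proof.
move=> Ex Ey.
have unim z : E z -> phi z <> 0 -> exists2 c, tau z = c *: phi z & c * c^* = 1.
  move=> Ez nz; have [c cE] := wigner_tau_phi Ez; exists c => //.
  have := wigner_nt Ez; rewrite cE !ipE mulrA wigner_norm; last by case: Ez.
  move=> h; apply: (mulIf (x := ip z z)); last by rewrite mul1r.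
  by rewrite -wigner_norm ?ip_neq0 //; case: Ez.
have z0 z : E z -> phi z = 0 -> (tau z = 0) * (z = 0).
  move=> Ez pz; have h : ip z z = 0 by rewrite -wigner_norm ?pz ?ip0l //; case: Ez.
  by split; apply: ip_eq0; rewrite ?wigner_nt.
have [/(z0 _ Ex)h|nx] := pselect (phi x = 0); first by rewrite !h !ipE mul0r.
have [/(z0 _ Ey)h|ny] := pselect (phi y = 0); first by rewrite !h !ipE mul0r.
have [c cE c1] := unim _ Ex nx; have [d dE d1] := unim _ Ey ny.
rewrite cE dE !ipE.
have [Wx _] := Ex; have [Wy _] := Ey.
have := norm_sqr_eq (phiP Wx Wy); rewrite -!ipC => h.
transitivity ((c * c^*) * (d * d^*) * (ip (phi x) (phi y) * ip (phi y) (phi x))).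
  by ring.
by rewrite c1 d1 !mul1r.
Qed.

(** Expanding [wigner_sum] and cancelling the squared moduli by [wigner_abs] leaves [n] times twice
    the real part. *)
Lemma wigner_re x y : E x -> E y ->
  ip (tau x) (tau y) + ip (tau y) (tau x) = ip x y + ip y x.
Proof.
move=> Ex Ey; have := wigner_sum Ex Ey; have := wigner_abs Ex Ey.
rewrite !conjD wigner_nC -!ipC => h1 h2.
apply: (mulfI wigner_n).
transitivity ((n + ip (tau x) (tau y)) * (n + ip (tau y) (tau x)) - n * n
  - ip (tau x) (tau y) * ip (tau y) (tau x)); first by ring.
by rewrite h1 h2; ring.
Qed.

(** The squared norm of the additivity defect involves only norms and symmetrised inner products,
    all of which [tau] preserves. *)
Lemma wigner_tauD x y : E x -> E y -> tau (x + y) = tau x + tau y.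
Proof.
move=> Ex Ey; have Exy : E (x + y) by apply: subspD wigner_subE _ _.
apply/subr0_eq/ip_eq0.
have h1 := wigner_re Ex Ey; have h2 := wigner_re Exy Ex; have h3 := wigner_re Exy Ey.
transitivity (ip (tau (x + y)) (tau (x + y)) + ip (tau x) (tau x) + ip (tau y) (tau y)
  + (ip (tau x) (tau y) + ip (tau y) (tau x))
  - (ip (tau (x + y)) (tau x) + ip (tau x) (tau (x + y)))
  - (ip (tau (x + y)) (tau y) + ip (tau y) (tau (x + y)))).
  by rewrite !ipE; ring.
by rewrite h1 h2 h3 !wigner_nt // !ipE; ring.
Qed.

Lemma wigner_tauR r x : r^* = r -> E x -> tau (r *: x) = r *: tau x.
Proof.
move=> rr Ex; have Erx : E (r *: x) by apply: subspZ wigner_subE _.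
apply/subr0_eq/ip_eq0.
have h := wigner_re Erx Ex.
transitivity (ip (tau (r *: x)) (tau (r *: x)) + r * r * ip (tau x) (tau x)
  - r * (ip (tau (r *: x)) (tau x) + ip (tau x) (tau (r *: x)))).
  by rewrite !ipE rr; ring.
by rewrite h !wigner_nt // !ipE rr; ring.
Qed.

(** The real part of [z] vanishes and its modulus is [m], so [z] is ['i * m] or its opposite; either
    value makes the squared norm of the corresponding defect zero. *)
Lemma wigner_tauI x : E x -> tau ('i *: x) = 'i *: tau x \/ tau ('i *: x) = - 'i *: tau x.
Proof.
move=> Ex; have Eix : E ('i *: x) by apply: subspZ wigner_subE _.
set m := ip x x; set z := ip (tau ('i *: x)) (tau x).
have zc : ip (tau x) (tau ('i *: x)) = - z.
  apply/eqP; rewrite -addr_eq0 wigner_re // !ipE conjCi mulNr; apply/eqP; ring.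
have ii : 'i * 'i = -1 :> C by rewrite -expr2 sqrCi.
have zz : z * z = ('i * m) * ('i * m).
  have := wigner_abs Eix Ex; rewrite zc !ipE conjCi -/z -/m => h.
  apply: oppr_inj; rewrite -mulrN h; ring.
have key s : s^* = - s -> s * s = -1 -> z = s * m -> tau ('i *: x) = s *: tau x.
  move=> sc ss zE; apply/subr0_eq/ip_eq0.
  rewrite !ipE zc -/z !wigner_nt // !ipE conjCi sc zE -/m.
  transitivity (m * (- ('i * 'i) + (s * s) + (s * s) - s * s)); first by ring.
  by rewrite ii ss; ring.
have : (z - 'i * m) * (z + 'i * m) = 0.
  by transitivity (z * z - ('i * m) * ('i * m)); [ring|rewrite zz subrr].
move/eqP; rewrite mulf_eq0 subr_eq0 addr_eq0 => /orP[/eqP zE|/eqP zE].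
  by left; apply: key => //; rewrite conjCi.
right; apply: key; rewrite ?conjN ?conjCi ?mulrNN //; by rewrite mulNr.
Qed.

(** If [x0] takes only the minus sign, then [tau x0] is nonzero, and additivity at [x + x0] excludes
    the plus sign at [x] unless [tau x] is zero, in which case both signs hold. *)
Lemma wigner_sign : exists b, forall x, E x -> tau ('i *: x) = sg b 'i *: tau x.
Proof.
have [h|/existsNP[x0 /not_implyP[Ex0 nx0]]] :=
  pselect (forall x, E x -> tau ('i *: x) = 'i *: tau x).
  by exists false.
have hx0 : tau ('i *: x0) = - 'i *: tau x0 by case: (wigner_tauI Ex0).
have t0 : tau x0 <> 0 by move=> t0; apply: nx0; rewrite hx0 t0 !scaler0.
exists true => x Ex /=; rewrite conjCi.
case: (wigner_tauI Ex) => // hx.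
have Es : E (x + x0) by apply: subspD wigner_subE _ _.
have Eix y : E y -> E ('i *: y) by move=> ?; apply: subspZ wigner_subE _.
have i0 : ('i : C) != 0 by rewrite neq0Ci.
have := wigner_tauI Es; rewrite scalerDr !wigner_tauD //; try exact: Eix.
rewrite hx hx0 !scalerDr => -[/addrI|/addIr] /eqP.
  rewrite -subr_eq0 -scalerBl -opprD scaler_eq0 oppr_eq0 -mulr2n mulrn_eq0 /= (negbTE i0) /=.
  by move/eqP.
move=> /eqP ->; done.
Qed.

Lemma wigner_at : exists b L, siso b W L /\ forall x, W x -> exists c, L x = c *: phi x.
Proof.
have [b hb] := wigner_sign.
have tauZ a x : E x -> tau (a *: x) = sg b a *: tau x.
  move=> Ex; have E1 : E ('Re a *: x) by apply: subspZ wigner_subE _.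
  have E2 : E ('Im a *: x) by apply: subspZ wigner_subE _.
  have E3 : E ('i *: ('Im a *: x)) by apply: subspZ wigner_subE _.
  have cR : ('Re a)^* = 'Re a by apply/CrealP/Creal_Re.
  have cI : ('Im a)^* = 'Im a by apply/CrealP/Creal_Im.
  rewrite {1}(Crect a) scalerDl -scalerA wigner_tauD // hb // !wigner_tauR //.
  rewrite scalerA -scalerDl; congr (_ *: _).
  by rewrite [in RHS](Crect a) sgD sgM !(@sg_real b ('Re a), @sg_real b ('Im a)).
(* [wigner_re] at [x] gives the real part, and at ['i *: x] the imaginary part. *)
have tau_ip x y : E x -> E y -> ip (tau x) (tau y) = sg b (ip x y).
  move=> Ex Ey; have Eix : E ('i *: x) by apply: subspZ wigner_subE _.
  have h1 := wigner_re Ex Ey; have h2 := wigner_re Eix Ey.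
  move: h2; rewrite hb // !ipE => h2.
  have i0 : ('i : C) != 0 by rewrite neq0Ci.
  have two : (2%:R : C) != 0 by rewrite pnatr_eq0.
  case: (b) h2 => /=; rewrite ?conjCK !conjCi ?conjN ?conjCi ?opprK !mulNr => h2.
    rewrite -ipC; apply: (mulfI (mulf_neq0 two i0)).
    transitivity ('i * (ip (tau x) (tau y) + ip (tau y) (tau x))
      - (- ('i * ip (tau x) (tau y)) + 'i * ip (tau y) (tau x))); first by ring.
    by rewrite h1 h2; ring.
  apply: (mulfI (mulf_neq0 two i0)).
  transitivity ('i * (ip (tau x) (tau y) + ip (tau y) (tau x))
      + ('i * ip (tau x) (tau y) - 'i * ip (tau y) (tau x))); first by ring.
  by rewrite h1 h2; ring.
pose c x := ip x e / n; pose r x := x - c x *: e.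
have n0 := wigner_n.
have Er x : W x -> E (r x).
  move=> Wx; split; first by apply: subspB => //; apply: subspZ.
  by rewrite /r !ipE -/n /c divfK // subrr.
have rE x : x = c x *: e + r x by rewrite addrC subrK.
(* Semilinear extension of [e] to [e'] and of [tau]. If [c x] is nonzero, [x] is a multiple of some
   [e + y], whose image is known; otherwise [x] lies in [E] and [wigner_tau_phi] applies. *)
exists b, (fun x => sg b (c x) *: e' + tau (r x)); split; last first.
  move=> x Wx; have [c0|cn] := eqVneq (c x) 0.
    rewrite c0 sg0 scale0r add0r.
    have rx : r x = x by rewrite /r c0 scale0r subr0.
    by rewrite rx; apply: wigner_tau_phi; rewrite -rx; apply: Er.
  set y := (c x)^-1 *: r x.
  have Ey : E y by apply: subspZ wigner_subE _; apply: Er.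
  have xE : x = c x *: (e + y).
    by rewrite /y scalerDr scalerA mulfV // scale1r -rE.
  have Wey : W (e + y) by apply: subspD => //; case: Ey.
  have [d dE] := wigner_prop Wx Wey xE.
  have -> : r x = c x *: y by rewrite /y scalerA mulfV // scale1r.
  rewrite tauZ // -scalerDr.
  have [p0|pn] := pselect (phi x = 0).
    have /ip_eq0 x0 : ip x x = 0 by rewrite -wigner_norm // p0 ip0l.
    by case/eqP: cn; rewrite /c x0 ip0l mul0r.
  have := prop_sym pn dE; rewrite wigner_phi // => h.
  have := congr1 (fun v => (sg b (c x) / k y) *: v) h.
  rewrite !scalerA mulfVK ?wigner_kn // => ->; by eexists.
have cD x y : c (x + y) = c x + c y by rewrite /c ipDl mulrDl.
have cZ a x : c (a *: x) = a * c x by rewrite /c ipZl mulrA.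
have rD x y : r (x + y) = r x + r y by rewrite /r cD scalerDl opprD addrACA.
have rZ a x : r (a *: x) = a *: r x by rewrite /r cZ -scalerA -scalerBr.
split.
- move=> x y Wx Wy; rewrite cD rD sgD scalerDl wigner_tauD; try exact: Er.
  by rewrite addrACA.
- move=> a x Wx; rewrite cZ rZ sgM tauZ; last exact: Er.
  by rewrite -scalerA -scalerDr.
- move=> x y Wx Wy; have Ex := Er _ Wx; have Ey := Er _ Wy; clearbody r c.
  rewrite {3}(rE x) {3}(rE y) !ipE wigner_tau_e // wigner_e_tau // tau_ip //.
  have [_ xe] := Ex; have [_ ye] := Ey.
  rewrite xe (ipC0 ye) wigner_norm // -/n !mulr0 !addr0 !add0r.
  by rewrite sgD !sgM sgJ (@sg_real b n) ?wigner_nC.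
Qed.

End Basepoint.

Lemma wigner : exists b L, siso b W L /\ forall x, W x -> exists c, L x = c *: phi x.
Proof.
have [[e [We ne]]|h] := pselect (exists e, W e /\ e <> 0).
  by have [k [tau h]] := wigner_tau_exists We ne; exact: (wigner_at We ne h).
exists false, id; split; first by split.
by move=> x Wx; exists 0; rewrite scale0r; apply: contrapT => nx; apply: h; exists x.
Qed.

End Wigner.

End InnerProduct.

(** * Uniqueness of the Wigner isometry up to a phase *)

Section Uniqueness.
Variables (C : numClosedFieldType) (V : lmodType C) (ip : V -> V -> C).
Hypothesis hip : ip_axioms ip.

(** The factor at [x + y] equals [p] after pairing with [T x], and [q] after pairing with [T y]. *)
Lemma siso_eq_prop_coef b b' (E : set V) (S T : V -> V) (x y : V) (p q : C) :
  subsp E -> siso ip b E S -> siso ip b' E T ->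
  (forall z, E z -> exists c, S z = c *: T z) ->
  E x -> E y -> x <> 0 -> y <> 0 -> ip x y = 0 ->
  S x = p *: T x -> S y = q *: T y -> p = q.
Proof.
move=> sE [SD _ _] [TD _ Ti] h Ex Ey nx ny xy Sx Sy.
have [d] := h _ (subspD sE Ex Ey).
rewrite SD // TD // Sx Sy scalerDr => e.
have pd : p = d.
  have := congr1 (fun v => ip v (T x)) e.
  rewrite !(ipE hip) !Ti // (ipC0 hip xy) sg0 !mulr0 !addr0.
  by rewrite sg_real ?ip_conj // => /mulIf -> //; apply: ip_neq0.
have qd : q = d.
  have := congr1 (fun v => ip v (T y)) e.
  rewrite !(ipE hip) !Ti // xy sg0 !mulr0 !add0r.
  by rewrite (@sg_real _ _ (ip y y)) ?ip_conj // => /mulIf -> //; apply: ip_neq0.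
by rewrite pd qd.
Qed.

Lemma sg_inj_bool b b' : sg b ('i : C) = sg b' 'i -> b = b'.
Proof.
have n0 : 'i + 'i != 0 :> C by rewrite -mulr2n mulrn_eq0 /= neq0Ci.
by case: b b' => [] [] //=; rewrite conjCi => /eqP; [|rewrite eq_sym];
  rewrite eq_sym -addr_eq0 (negbTE n0).
Qed.

(** Two orthogonal directions are required: on a line, a linear and a conjugate-linear isometry are
    always pointwise proportional. *)
Lemma siso_prop b b' (E : set V) (S T : V -> V) (e g : V) :
  subsp E -> siso ip b E S -> siso ip b' E T ->
  (forall x, E x -> exists c, S x = c *: T x) ->
  E e -> E g -> e <> 0 -> g <> 0 -> ip e g = 0 ->
  b = b' /\ exists c, c * c^* = 1 /\ forall x, E x -> S x = c *: T x.
Proof.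
move=> sE Siso Tiso h Ee Eg ne ng eg.
have [c Se] := h _ Ee.
have orth x : E x -> x <> 0 -> ip e x = 0 -> S x = c *: T x.
  move=> Ex nx ex; have [d Sx] := h _ Ex.
  by rewrite (siso_eq_prop_coef sE Siso Tiso h Ee Ex ne nx ex Se Sx).
have [SD SZ Si] := Siso; have [TD TZ Ti] := Tiso.
have i0 : ('i : C) != 0 by rewrite neq0Ci.
have c1 : c * c^* = 1.
  have := Si _ _ Ee Ee; rewrite Se !(ipE hip) Ti // !sg_real ?ip_conj //.
  rewrite mulrA => h1; apply: (mulIf (ip_neq0 hip ne)); by rewrite mul1r.
have cn : c != 0 by apply/eqP => c0; move/eqP: c1; rewrite c0 mul0r eq_sym oner_eq0.
have Tn x : E x -> x <> 0 -> T x <> 0.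
  move=> Ex nx Tx0; have := Ti _ _ Ex Ex; rewrite Tx0 (ip0l hip) sg_real ?ip_conj //.
  by move/esym/(ip_eq0 hip).
(* Both [g] and ['i *: g] are orthogonal to [e], so both carry the factor [c]; comparing them
   identifies the two actions on ['i]. *)
have bb : b = b'.
  have Eig : E ('i *: g) by apply: subspZ.
  have nig : 'i *: g <> 0 by move/eqP; rewrite scaler_eq0 (negbTE i0) /= => /eqP.
  have eig : ip e ('i *: g) = 0 by rewrite (ipZr hip) eg mulr0.
  have := orth _ Eig nig eig; rewrite SZ // TZ // (orth g) // !scalerA (mulrC c).
  move=> /eqP; rewrite -subr_eq0 -scalerBl scaler_eq0 -mulrBl mulf_eq0 (negbTE cn) orbF.
  by rewrite subr_eq0 => /orP[/eqP/sg_inj_bool|/eqP/(Tn _ Eg ng)].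
split=> //; exists c; split=> // x Ex.
set a := ip x e / ip e e; set r := x - a *: e.
have Er : E r by apply: subspB => //; apply: subspZ.
have er : ip e r = 0.
  apply: (ipC0 hip); rewrite /r (ipBl hip) (ipZl hip) /a divfK ?subrr //.
  exact: ip_neq0.
have -> : x = a *: e + r by rewrite addrC subrK.
have Eae : E (a *: e) by apply: subspZ.
rewrite SD // TD // SZ // TZ // Se bb.
have -> : S r = c *: T r.
  have [r0|nr] := pselect (r = 0); last exact: orth.
  have S0 : S 0 = 0 by have := SZ 0 _ Ee; rewrite scale0r sg0 scale0r.
  have T0 : T 0 = 0 by have := TZ 0 _ Ee; rewrite scale0r sg0 scale0r.
  by rewrite r0 S0 T0 scaler0.
by rewrite scalerDr !scalerA (mulrC c).
Qed.

Lemma siso0 b (E : set V) L : subsp E -> siso ip b E L -> L 0 = 0.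
Proof.
by move=> [E0 _] [_ LZ _]; have := LZ 0 _ E0; rewrite !scale0r sg0 scale0r.
Qed.

Lemma sisoB b (E : set V) L x y : subsp E -> siso ip b E L -> E x -> E y ->
  L (x - y) = L x - L y.
Proof.
move=> sE [LD LZ _] Ex Ey; have EN : E (- y) by apply: subspN.
by rewrite LD // -scaleN1r LZ // sgN sg1 scaleN1r.
Qed.

Lemma siso_inj b (E : set V) L x y : subsp E -> siso ip b E L -> E x -> E y ->
  L x = L y -> x = y.
Proof.
move=> sE Li Ex Ey e; apply/subr0_eq/(ip_eq0 hip).
have Exy : E (x - y) by apply: subspB.
have [_ _ Lip] := Li; have := Lip _ _ Exy Exy.
rewrite (sisoB sE Li) // e subrr (ip0l hip) sg_real ?ip_conj //.
Qed.

Lemma siso_sub b (E F : set V) L : F `<=` E -> siso ip b E L -> siso ip b F L.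
Proof.
move=> FE [LD LZ Li]; split=> [x y Fx Fy|a x Fx|x y Fx Fy].
- by rewrite LD //; apply: FE.
- by rewrite LZ //; apply: FE.
- by rewrite Li //; apply: FE.
Qed.

End Uniqueness.

(** * Recursive choice *)

Section Choice.
Variables (T : eqType) (Q : seq T -> T -> Prop).
Hypothesis Qex : forall s, exists x, Q s x.

(** Each term may depend on all earlier ones: the finite prefixes are built by iteration and the
    sequence is read off from them. *)
Lemma rec_choice : exists e : nat -> T, forall n, Q [seq e i | i <- iota 0 n] (e n).
Proof.
have [g gP] := choice Qex.
pose pref n := iter n (fun s => rcons s (g s)) [::].
exists (fun n => g (pref n)) => n.
suff -> : [seq g (pref i) | i <- iota 0 n] = pref n by exact: gP.
by elim: n => // n IHn; rewrite -[n.+1]addn1 iotaD map_cat /= IHn cats1 addn1.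
Qed.

End Choice.

(** * Closed subspaces of a Hilbert space *)

Section HilbertSpace.
Variables (R : realType) (H : lmodType R[i]) (ip : H -> H -> R[i]).
Hypothesis hH : hilbert_space ip.
Local Notation C := R[i].

Let hip : ip_axioms ip. Proof. by case: hH. Qed.

(** Real-valued squared norms keep the estimates polynomial, without square roots. *)
Definition nsq (x : H) : R := complex.Re (ip x x).

Lemma ip_nsq x : ip x x = real_complex R (nsq x).
Proof. by rewrite RRe_real // ger0_real // (ip_ge0 hip). Qed.

Lemma nsq_ge0 x : 0 <= nsq x.
Proof. by rewrite -ler0c -ip_nsq (ip_ge0 hip). Qed.

Lemma nsq_eq0 x : nsq x = 0 -> x = 0.
Proof. by move=> x0; apply: (ip_eq0 hip); rewrite ip_nsq x0. Qed.

Lemma hnorm_lt x e : 0 < e -> (hnorm ip x < e) = (nsq x < e ^+ 2).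
Proof.
move=> e0; rewrite -[in RHS](sqr_sqrtr (nsq_ge0 x)).
by rewrite ltr_pXn2r // ?nnegrE ?sqrtr_ge0 // ltW.
Qed.

Lemma nsqN x : nsq (- x) = nsq x.
Proof. by rewrite /nsq !(ipE hip) opprK. Qed.

Lemma nsqBC x y : nsq (x - y) = nsq (y - x).
Proof. by rewrite -nsqN opprB. Qed.

Lemma parallelogram x y : nsq (x + y) + nsq (x - y) = 2 * nsq x + 2 * nsq y.
Proof.
apply: complexI; rewrite !rmorphD !rmorphM rmorph_nat /= -!ip_nsq !(ipE hip); ring.
Qed.

Lemma nsq_le2 x y : nsq (x + y) <= 2 * nsq x + 2 * nsq y.
Proof. by rewrite -parallelogram lerDl nsq_ge0. Qed.

Definition csq (z : C) : R := (complex.Re z) ^+ 2 + (complex.Im z) ^+ 2.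

Lemma csqE z : real_complex R (csq z) = `|z| ^+ 2.
Proof. exact: add_Re2_Im2. Qed.

Lemma csq_ge0 z : 0 <= csq z.
Proof. by rewrite addr_ge0 // sqr_ge0. Qed.

Lemma csq_eq0 z : csq z = 0 -> z = 0.
Proof.
move=> z0; have := csqE z; rewrite z0 => /esym/eqP.
by rewrite sqrf_eq0 normr_eq0 => /eqP.
Qed.

Lemma csq_leD z w : csq (z + w) <= 2 * csq z + 2 * csq w.
Proof.
case: z w => [a b] [c d]; rewrite /csq /=.
have := sqr_ge0 (a - c); have := sqr_ge0 (b - d); nra.
Qed.

Lemma cauchy_schwarz_real x y : csq (ip x y) <= nsq x * nsq y.
Proof.
by rewrite -lecR csqE rmorphM /= -!ip_nsq; apply: (cauchy_schwarz hip).
Qed.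

Lemma le_of_eps (a b : R) : (forall e, 0 < e -> a <= e * b) -> a <= 0.
Proof.
move=> h; rewrite leNgt; apply/negP => a0.
have b0 : 0 < b by have := h _ ltr01; rewrite mul1r; apply: lt_le_trans.
have := h (a / 2 / b); rewrite !divr_gt0 // => /(_ isT).
by rewrite divfK ?gt_eqF //; lra.
Qed.

Lemma hcvg_nsq u l : hcvg ip u l <->
  forall e, 0 < e -> exists K : nat, forall n, (K <= n)%N -> nsq (u n - l) < e.
Proof.
split=> h e e0.
  have [|K hK] := h (Num.sqrt e); first by rewrite sqrtr_gt0.
  exists K => n /hK; rewrite hnorm_lt ?sqrtr_gt0 // sqr_sqrtr //; exact: ltW.
have [|K hK] := h (e ^+ 2); first by rewrite exprn_gt0.
by exists K => n /hK; rewrite hnorm_lt.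
Qed.

Lemma hcauchy_nsq u : hcauchy ip u <->
  forall e, 0 < e -> exists K : nat, forall n m, (K <= n)%N -> (K <= m)%N ->
    nsq (u n - u m) < e.
Proof.
split=> h e e0.
  have [|K hK] := h (Num.sqrt e); first by rewrite sqrtr_gt0.
  exists K => n m Kn Km; have := hK _ _ Kn Km.
  by rewrite hnorm_lt ?sqrtr_gt0 // sqr_sqrtr //; exact: ltW.
have [|K hK] := h (e ^+ 2); first by rewrite exprn_gt0.
by exists K => n m Kn Km; have := hK _ _ Kn Km; rewrite hnorm_lt.
Qed.

Lemma ortho_closed A : closed_subspace ip (ortho ip A).
Proof.
split.
  split=> [x _|a x y Ax Ay z Az]; first by rewrite (ip0r hip).
  by rewrite !(ipE hip) Ax // Ay // mulr0 addr0.
move=> u l Au /hcvg_nsq ul x Ax; apply: csq_eq0; apply/eqP.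
rewrite eq_le csq_ge0 andbT; apply: (@le_of_eps _ (nsq x)) => e e0.
have [K hK] := ul _ e0; have := hK _ (leqnn K) => {}hK.
have -> : ip x l = ip x (l - u K) by rewrite !(ipE hip) (Au K x Ax) subr0.
apply: (le_trans (cauchy_schwarz_real _ _)).
by rewrite mulrC ler_wpM2r ?nsq_ge0 // nsqBC ltW.
Qed.

(** Subtracting from [w] its component along [y] lowers the squared norm by [csq (ip w y) / nsq y],
    which near-minimality bounds by [e]. *)
Lemma almost_minimal_ortho (Y : set H) w e y : subsp Y -> Y y ->
  (forall y', Y y' -> nsq w <= nsq (w - y') + e) -> csq (ip w y) <= e * nsq y.
Proof.
move=> sY Yy h.
have [->|ny] := pselect (y = 0).
  have n00 : nsq 0 = 0 by apply: complexI; rewrite -ip_nsq (ip0r hip).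
  by apply: le_trans (cauchy_schwarz_real _ _) _; rewrite n00 !mulr0.
have n0 : 0 < nsq y by rewrite -ltcR -ip_nsq (ip_gt0 hip).
have := h _ (subspZ (ip w y / ip y y) sY Yy).
have -> : nsq (w - (ip w y / ip y y) *: y) = nsq w - csq (ip w y) / nsq y.
  apply: complexI; rewrite rmorphB fmorph_div /= -!ip_nsq csqE.
  rewrite norm2_ip // !(ipE hip) conjM conjV (ip_conj hip) -(ipC hip).
  by have := ip_neq0 hip ny => n1; field.
by rewrite -addrA lerDl -subr_ge0 subr0 addrC subr_ge0 ler_pdivrMr.
Qed.

Lemma projection Y x : closed_subspace ip Y ->
  exists y z, [/\ Y y, ortho ip Y z & x = y + z].
Proof.
move=> [sY cY]; have Y0 : Y 0 by case: sY.
pose D := [set nsq (x - y) | y in Y].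
have Dlb : has_lbound D by exists 0 => _ [y _ <-]; apply: nsq_ge0.
have Dinf : has_inf D by split => //; exists (nsq (x - 0)), 0.
pose d := inf D.
have dle y : Y y -> d <= nsq (x - y) by move=> Yy; apply: ge_inf => //; exists y.
pose eps (n : nat) : R := n.+1%:R^-1.
have eps0 n : 0 < eps n by rewrite invr_gt0 ltr0n.
have epsP e : 0 < e -> exists K : nat, forall n, (K <= n)%N -> eps n < e.
  move=> e0; exists (Num.truncn e^-1) => n Kn.
  rewrite -[e]invrK ltf_pV2 ?posrE ?invr_gt0 ?ltr0n //.
  by apply: (lt_le_trans (truncnS_gt _)); rewrite ler_nat.
have /choice[u uP] n : exists y, Y y /\ nsq (x - y) < d + eps n.
  by have [_ [y Yy <-] h] := inf_adherent (eps0 n) Dinf; exists y.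
have uY n : Y (u n) by case: (uP n).
have ud n : nsq (x - u n) < d + eps n by case: (uP n).
(* Midpoints stay in [Y], so the parallelogram law bounds [nsq (u n - u m)] by
   [2 * eps n + 2 * eps m]; hence the choice of [e / 4]. *)
have cau : hcauchy ip u.
  apply/hcauchy_nsq => e e0; have [|K hK] := epsP (e / 4); first by rewrite divr_gt0.
  exists K => n m /hK en /hK em.
  have := parallelogram (x - u n) (x - u m).
  have -> : x - u n - (x - u m) = u m - u n by rewrite opprB addrC addrA subrK.
  have -> : nsq (x - u n + (x - u m)) = 4 * nsq (x - 2^-1 *: (u n + u m)).
    apply: complexI; rewrite rmorphM rmorph_nat /= -!ip_nsq.
    have -> : x - u n + (x - u m) = 2 *: (x - 2^-1 *: (u n + u m)).
      by rewrite scalerBr scalerA divff ?pnatr_eq0 // scale1r scaler_nat addrACA opprD.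
    by rewrite (ipZl hip) (ipZr hip) conjC_nat; ring.
  have := dle _ (subspZ 2^-1 sY (subspD sY (uY n) (uY m))).
  have := ud n; have := ud m; rewrite (nsqBC (u m)); lra.
have [l ul] : exists l, hcvg ip u l by case: hH => _; apply.
have Yl : Y l by exact: cY ul.
exists l, (x - l); split=> //; last by rewrite addrC subrK.
move=> y Yy; apply: (ipC0 hip); apply: csq_eq0; apply/eqP.
(* The inner product splits at [u n]; each half contributes at most [2 * e * nsq y], by
   near-minimality and by convergence respectively. *)
rewrite eq_le csq_ge0 andbT; apply: (@le_of_eps _ (4 * nsq y)) => e e0.
move/hcvg_nsq: ul => /(_ _ e0)[K1 hK1]; have [K2 hK2] := epsP _ e0.
pose n := maxn K1 K2.
have h1 := hK1 n (leq_maxl _ _); have h2 := hK2 n (leq_maxr _ _).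
have -> : ip (x - l) y = ip (x - u n) y + ip (u n - l) y by rewrite -(ipDl hip) addrA subrK.
apply: (le_trans (csq_leD _ _)).
have h3 := cauchy_schwarz_real (u n - l) y.
have h4 : csq (ip (x - u n) y) <= eps n * nsq y.
  apply: (almost_minimal_ortho sY) => // y' Yy'.
  apply: (le_trans (ltW (ud n))); rewrite lerD2r -addrA -opprD; apply: dle.
  exact: subspD.
have := nsq_ge0 y; have := nsq_ge0 (u n - l); have := eps0 n; nra.
Qed.

End HilbertSpace.

(** * Closed spans, hyperplanes and one-dimensional extensions *)

Section Subspaces.
Variables (R : realType) (H : lmodType R[i]) (ip : H -> H -> R[i]).
Hypothesis hH : hilbert_space ip.
Local Notation C := R[i].
Local Notation ortho := (ortho ip).
Local Notation closed := (closed_subspace ip).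

Let hip : ip_axioms ip. Proof. by case: hH. Qed.

(** The closed linear span as a double orthogonal: closedness is immediate, and [clspan_min]
    recovers minimality from the projection theorem. *)
Definition clspan (A : set H) : set H := ortho (ortho A).
Definition perp (X : set H) (x : H) : set H := [set y | X y /\ ip x y = 0].
Definition addl (X : set H) (v : H) : set H :=
  [set z | exists (a : C) (t : H), X t /\ z = t + a *: v].

Lemma ortho_anti A B : A `<=` B -> ortho B `<=` ortho A.
Proof. by move=> AB x Bx a /AB; apply: Bx. Qed.

Lemma ortho_self X x : X x -> ortho X x -> x = 0.
Proof. by move=> Xx /(_ _ Xx)/(ip_eq0 hip). Qed.

Lemma clspan_sub A : A `<=` clspan A.
Proof. by move=> x Ax y /(_ _ Ax)/(ipC0 hip). Qed.

Lemma clspan_closed A : closed (clspan A).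
Proof. exact: (ortho_closed hH). Qed.

Lemma clspan_closed_sub Y : closed Y -> clspan Y `<=` Y.
Proof.
move=> cY x Yx; have [y [z [Yy Yz xE]]] := projection hH x cY.
suff z0 : z = 0 by rewrite xE z0 addr0.
apply: (ip_eq0 hip); rewrite -(Yx z Yz) xE (ipDr hip).
by rewrite (ipC0 hip (Yz _ Yy)) add0r.
Qed.

Lemma clspan_min A Y : closed Y -> A `<=` Y -> clspan A `<=` Y.
Proof.
move=> cY AY; apply: subset_trans (clspan_closed_sub cY).
by do 2 apply: ortho_anti.
Qed.

Lemma ortho_clspan A x : ortho A x -> ortho (clspan A) x.
Proof. by move=> Ax y /(_ _ Ax)/(ipC0 hip). Qed.

Lemma closedI X Y : closed X -> closed Y -> closed (X `&` Y).
Proof.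
move=> [[X0 sX] cX] [[Y0 sY] cY]; split; first split => //.
  by move=> a x y [Xx Yx] [Xy Yy]; split; [apply: sX|apply: sY].
move=> u l uXY ul; split; [apply: cX ul|apply: cY ul] => n; by case: (uXY n).
Qed.

Lemma perpE X x : perp X x = X `&` ortho [set x].
Proof.
apply/seteqP; split=> y [Xy xy]; split=> //; last exact: xy.
by move=> _ ->.
Qed.

Lemma closed_perp X x : closed X -> closed (perp X x).
Proof. by move=> cX; rewrite perpE; apply: closedI => //; apply: (ortho_closed hH). Qed.

Lemma perp_sub X x : perp X x `<=` X.
Proof. by move=> y []. Qed.

Lemma addl_sub X v : X `<=` addl X v.
Proof. by move=> x Xx; exists 0, x; rewrite scale0r addr0. Qed.

Lemma addl_v X v : subsp X -> addl X v v.
Proof. by move=> [X0 _]; exists 1, 0; rewrite scale1r add0r. Qed.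

Lemma addl_min X v Y : subsp Y -> X `<=` Y -> Y v -> addl X v `<=` Y.
Proof.
by move=> sY XY Yv _ [a [t [Xt ->]]]; apply: subspD (XY _ Xt) (subspZ a sY Yv).
Qed.

Lemma addl_mono X Y v : X `<=` Y -> addl X v `<=` addl Y v.
Proof. by move=> XY _ [a [t [/XY Yt ->]]]; exists a, t. Qed.

Lemma addl_shift X p q : subsp X -> X p -> addl X (p + q) = addl X q.
Proof.
move=> sX Xp; apply/seteqP; split=> _ [a [t [Xt ->]]].
  exists a, (t + a *: p); split; first by apply: subspD => //; apply: subspZ.
  by rewrite scalerDr addrA.
exists a, (t - a *: p); split; first by apply: subspB => //; apply: subspZ.
by rewrite scalerDr addrA subrK.
Qed.

(** After replacing [v] by its component [q] orthogonal to [X], the sum equals its double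
    orthogonal: removing the components along [X] and [q] from a vector there leaves something
    orthogonal to itself. *)
Lemma closed_addl X v : closed X -> closed (addl X v).
Proof.
move=> cX; have [sX _] := cX; have [p [q [Xp Xq ->]]] := projection hH v cX.
rewrite addl_shift //.
suff -> : addl X q = clspan (addl X q) by apply: clspan_closed.
apply/seteqP; split; first exact: clspan_sub.
move=> x Xqx; have [y [z [Xy Xz xE]]] := projection hH x cX.
set a := ip z q / ip q q; set r := z - a *: q.
have Xr : ortho X r.
  by move=> t Xt; rewrite /r !(ipE hip) Xz // Xq // mulr0 subrr.
have qr : ip r q = 0.
  rewrite /r !(ipE hip) /a; have [->|nq] := pselect (q = 0).
    by rewrite !(ipE hip) mulr0 subrr.
  by rewrite divfK ?subrr //; apply: ip_neq0.
have rx : ip r x = 0.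
  apply: Xqx => _ [c [t [Xt ->]]].
  by rewrite (ipDl hip) (ipZl hip) Xr // (ipC0 hip qr) mulr0 addr0.
have zE : z = r + a *: q by rewrite subrK.
exists a, y; split=> //; clearbody r.
suff r0 : r = 0 by rewrite xE zE r0 add0r.
apply: (ip_eq0 hip); rewrite -[RHS]rx xE zE !(ipE hip) qr (ipC0 hip (Xr _ Xy)).
by rewrite mulr0 addr0 add0r.
Qed.

(** Infinite dimension in the form consumed by recursive constructions: there is always room for one
    more orthonormal vector. *)
Definition idim (X : set H) : Prop := forall s : seq H,
  exists x, [/\ X x, ip x x = 1 & forall y, y \in s -> ip x y = 0].

Lemma unit_vector x : x <> 0 -> exists c : C, ip (c *: x) (c *: x) = 1.
Proof.
move=> nx; have n0 := ip_neq0 hip nx.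
exists (sqrtC (ip x x))^-1; rewrite !(ipE hip) mulrA.
have sr : (sqrtC (ip x x))^* = sqrtC (ip x x).
  by apply/CrealP; rewrite ger0_real // sqrtC_ge0 (ip_ge0 hip).
by rewrite conjV sr -invfM -expr2 sqrtCK mulVf.
Qed.

(** Orthogonality to [s] imposes [size s] linear conditions on combinations of [(size s).+1]
    independent vectors, so a nonzero solution exists. *)
Lemma infinite_dim_idim X : subsp X -> infinite_dim X -> idim X.
Proof.
move=> sX iX s; have [v [Xv vind]] := iX (size s).+1.
pose A : 'M[C]_((size s).+1, size s) := \matrix_(i, j) ip (v i) s`_j.
have : (kermx A != 0).
  by rewrite kermx_eq0 /row_free neq_ltn ltnS rank_leq_col.
move=> /rowV0Pn[c /sub_kermxP cA c0].
pose x := \sum_i c 0 i *: v i.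
have Xx : X x.
  apply: (big_ind X); first by case: sX.
    by move=> a b; apply: subspD.
  by move=> i _; apply: subspZ.
have nx : x <> 0.
  move=> /vind h; case/eqP: c0; apply/rowP => i; by rewrite h mxE.
have xs y : y \in s -> ip x y = 0.
  move=> ys; have ji : (index y s < size s)%N by rewrite index_mem.
  have := congr1 (fun M : 'rV_(size s) => M 0 (Ordinal ji)) cA.
  rewrite !mxE => <-; rewrite /x.
  rewrite (big_morph (fun z => ip z y) (fun a b => ipDl hip a b y) (ip0l hip y)).
  by apply: eq_bigr => i _; rewrite (ipZl hip) mxE /= nth_index.
have [a a1] := unit_vector nx; exists (a *: x); split=> //; first exact: subspZ.
by move=> y ys; rewrite (ipZl hip) xs // mulr0.
Qed.

Lemma orthonormal_choice (Q : seq H -> H -> Prop) :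
  (forall s, exists x, [/\ Q s x, ip x x = 1 & forall y, y \in s -> ip x y = 0]) ->
  exists e : nat -> H, (forall n, Q [seq e i | i <- iota 0 n] (e n)) /\
    forall n m, ip (e n) (e m) = (n == m)%:R.
Proof.
move=> /rec_choice[e eP]; exists e; split; first by move=> n; case: (eP n).
have lt n m : (m < n)%N -> ip (e n) (e m) = 0.
  move=> mn; case: (eP n) => _ _; apply; apply: map_f; by rewrite mem_iota.
move=> n m; case: (ltngtP n m) => [nm|mn|->]; last by case: (eP m).
  exact/(ipC0 hip)/lt.
exact: lt.
Qed.

(** The subspace may vary with the index, so vectors from several subspaces can be interleaved in
    one orthonormal sequence. *)
Lemma idim_orthonormal (X : nat -> set H) : (forall n, idim (X n)) ->
  exists e : nat -> H, (forall n, X n (e n)) /\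
    forall n m, ip (e n) (e m) = (n == m)%:R.
Proof.
move=> iX.
have [|e [eX eo]] := @orthonormal_choice (fun s => X (size s)).
  by move=> s; have [x [Xx x1 xs]] := iX (size s) s; exists x.
by exists e; split=> // n; have := eX n; rewrite size_map size_iota.
Qed.

Lemma orthogonal_infinite_dim (X : set H) (e : nat -> H) : (forall n, X (e n)) ->
  (forall n, ip (e n) (e n) != 0) -> (forall n m, n <> m -> ip (e n) (e m) = 0) ->
  infinite_dim X.
Proof.
move=> Xe en eo n; exists (fun i => e i); split=> // c c0 i.
have := congr1 (fun z => ip z (e i)) c0.
rewrite (big_morph (fun z => ip z (e i)) (fun a b => ipDl hip a b _) (ip0l hip _)).
rewrite (bigD1 i) //= big1 ?addr0; last first.
  by move=> j ji; rewrite (ipZl hip) eo ?mulr0 //; apply/eqP.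
rewrite (ipZl hip) (ip0l hip) => /eqP.
by rewrite mulf_eq0 (negbTE (en i)) orbF => /eqP.
Qed.

Lemma orthogonal_idim (X : set H) (e : nat -> H) : subsp X -> (forall n, X (e n)) ->
  (forall n, ip (e n) (e n) != 0) -> (forall n m, n <> m -> ip (e n) (e m) = 0) ->
  idim X.
Proof.
by move=> sX Xe en eo; apply: infinite_dim_idim (orthogonal_infinite_dim Xe en eo).
Qed.

Lemma subsequence_idim (X : set H) (e : nat -> H) (g : nat -> nat) : subsp X ->
  (forall n m, ip (e n) (e m) = (n == m)%:R) -> injective g ->
  (forall n, X (e (g n))) -> idim X.
Proof.
move=> sX eo gi Xe; apply: (orthogonal_idim sX Xe) => [n|n m nm].
  by rewrite eo eqxx oner_eq0.
by rewrite eo; case: eqP => // /gi.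
Qed.

Lemma idim_infinite_dim X : idim X -> infinite_dim X.
Proof.
move=> iX; have [e [eX eo]] := @idim_orthonormal (fun=> X) (fun=> iX).
apply: (orthogonal_infinite_dim eX) => [n|n m nm]; first by rewrite eo eqxx oner_eq0.
by rewrite eo; case: eqP.
Qed.

Lemma idim_sub X Y : X `<=` Y -> idim X -> idim Y.
Proof. by move=> XY iX s; have [x [/XY Yx x1 xs]] := iX s; exists x. Qed.

Lemma idim_perp X x : idim X -> idim (perp X x).
Proof.
move=> iX s; have [y [Xy y1 ys]] := iX (x :: s); exists y; split=> //.
  by split=> //; apply: (ipC0 hip); apply: ys; rewrite mem_head.
by move=> z zs; apply: ys; rewrite in_cons zs orbT.
Qed.

Lemma GinfP X : Ginf ip X <-> [/\ closed X, idim X & idim (ortho X)].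
Proof.
split=> [[cX iX iX']|[cX iX iX']]; split=> //.
- by apply: infinite_dim_idim => //; case: cX.
- by apply: infinite_dim_idim => //; case: (ortho_closed hH X).
- exact: idim_infinite_dim.
- exact: idim_infinite_dim.
Qed.

Lemma Ginf_closed X : Ginf ip X -> closed X.
Proof. by case. Qed.

Lemma Ginf_subsp X : Ginf ip X -> subsp X.
Proof. by case=> -[]. Qed.

Lemma Ginf_idim X : Ginf ip X -> idim X.
Proof. by case/GinfP. Qed.

Lemma Ginf_sub X Y : Ginf ip X -> closed Y -> idim Y -> Y `<=` X -> Ginf ip Y.
Proof.
move=> /GinfP[cX iX iX'] cY iY YX; apply/GinfP; split=> //.
exact: idim_sub (ortho_anti YX) iX'.
Qed.

Lemma Ginf_perp X x : Ginf ip X -> Ginf ip (perp X x).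
Proof.
move=> GX; apply: Ginf_sub (GX) _ _ (@perp_sub _ _).
  exact/closed_perp/Ginf_closed.
exact/idim_perp/Ginf_idim.
Qed.

Lemma Ginf_addl X v : Ginf ip X -> Ginf ip (addl X v).
Proof.
move=> /GinfP[cX iX iX']; apply/GinfP; split; first exact: closed_addl.
  exact: idim_sub (@addl_sub X v) iX.
apply: idim_sub (idim_perp v iX') => y [Xy vy] _ [a [t [Xt ->]]].
by rewrite !(ipE hip) Xy // vy mulr0 addr0.
Qed.

(** The normal is the component of the missing vector [v] orthogonal to the hyperplane. *)
Lemma hyperplanesP X Z : closed X ->
  hyperplanes ip X Z <-> exists x, [/\ X x, x <> 0 & Z = perp X x].
Proof.
move=> cX; have [sX _] := cX; split.
  move=> [cZ ZX [v [Xv Zv XE]]]; have [sZ _] := cZ.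
  have [p [q [Zp Zq vE]]] := projection hH v cZ.
  exists q; split.
  - have -> : q = v - p by rewrite vE addrC addKr.
    by apply: subspB => //; apply: ZX.
  - by move=> q0; apply: Zv; rewrite vE q0 addr0.
  - apply/seteqP; split=> [z Zz|y [Xy qy]].
      by split; [apply: ZX|apply/(ipC0 hip)/Zq].
    have [a [z [Zz yE]]] := XE _ Xy.
    have nq : q <> 0 by move=> q0; apply: Zv; rewrite vE q0 addr0.
    suff a0 : a = 0 by rewrite yE a0 scale0r add0r.
    move: qy; rewrite yE vE !(ipE hip) (ipC0 hip (Zq _ Zp)) (ipC0 hip (Zq _ Zz)).
    rewrite add0r addr0 => /eqP; rewrite mulf_eq0 (negbTE (ip_neq0 hip nq)) orbF.
    by move/eqP => ac; rewrite -[a]conjCK ac conjC0.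
move=> [x [Xx nx ->]]; split; [exact: closed_perp|exact: perp_sub|].
have n0 := ip_neq0 hip nx.
exists x; split=> //; first by move=> [_ /(ip_eq0 hip)].
move=> y Xy; exists (ip y x / ip x x), (y - (ip y x / ip x x) *: x); split.
  split; first by apply: subspB => //; apply: subspZ.
  by apply: (ipC0 hip); rewrite !(ipE hip) divfK // subrr.
by rewrite addrC subrK.
Qed.

Lemma hyperplane_perp X x : closed X -> X x -> x <> 0 -> hyperplanes ip X (perp X x).
Proof. by move=> cX Xx nx; apply/hyperplanesP => //; exists x. Qed.

(** The component of [x] orthogonal to [Y] serves as normal. Thus a closed subspace of [X] is
    determined by the hyperplanes of [X] above it. *)
Lemma hyperplane_separation X Y x : closed X -> closed Y -> Y `<=` X ->
  X x -> ~ Y x -> exists Z, [/\ hyperplanes ip X Z, Y `<=` Z & ~ Z x].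
Proof.
move=> cX cY YX Xx Yx; have [sX _] := cX.
have [p [q [Yp Yq xE]]] := projection hH x cY.
have nq : q <> 0 by move=> q0; apply: Yx; rewrite xE q0 addr0.
have Xq : X q.
  have -> : q = x - p by rewrite xE addrC addKr.
  by apply: subspB => //; apply: YX.
exists (perp X q); split; first exact: hyperplane_perp.
  by move=> y Yy; split; [apply: YX|apply/(ipC0 hip)/Yq].
by move=> [_]; rewrite xE (ipDr hip) (ipC0 hip (Yq _ Yp)) add0r => /(ip_eq0 hip).
Qed.

Lemma hyperplane_max X Z Y : closed X -> hyperplanes ip X Z -> subsp Y ->
  Z `<=` Y -> Y `<=` X -> Y = Z \/ Y = X.
Proof.
move=> cX /(hyperplanesP _ cX)[x [Xx nx ->]] sY ZY YX.
have [h|/existsNP[y /not_implyP[Yy xy]]] := pselect (forall y, Y y -> ip x y = 0).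
  by left; apply/seteqP; split=> // y Yy; split; [apply: YX|apply: h].
right; apply/seteqP; split=> // w Xw.
pose c := (ip x w / ip x y)^*.
have -> : w = (w - c *: y) + c *: y by rewrite subrK.
apply: subspD => //; last exact: subspZ.
apply: ZY; split.
  by apply: subspB => //; [case: cX|apply: subspZ; [case: cX|apply: YX]].
by rewrite !(ipE hip) conjCK divfK ?subrr //; apply/eqP.
Qed.

Lemma perp_inj X x y : subsp X -> X x -> X y -> x <> 0 ->
  perp X x `<=` perp X y -> exists c, y = c *: x.
Proof.
move=> sX Xx Xy nx h; exists (ip y x / ip x x); set c := _ / _.
set r := y - c *: x.
have n0 := ip_neq0 hip nx.
have rx : ip r x = 0 by rewrite /r !(ipE hip) /c divfK // subrr.
have [_ yr] : perp X y r.
  apply: h; split; last exact: (ipC0 hip).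
  by apply: subspB => //; apply: subspZ.
apply/subr0_eq/(ip_eq0 hip); rewrite -/r.
by rewrite {1}/r (ipBl hip) yr (ipZl hip) (ipC0 hip rx) mulr0 subrr.
Qed.

(** A convergent sequence in the image pulls back to a Cauchy sequence, which converges in [X] by
    completeness. *)
Lemma image_closed b (E X : set H) L : subsp E -> siso ip b E L -> X `<=` E ->
  closed X -> closed (L @` X).
Proof.
move=> sE Li XE [sX cX]; have [LD LZ Lip] := Li; split.
  split; first by exists 0; [case: sX|apply: (siso0 sE Li)].
  move=> a _ _ [x Xx <-] [y Xy <-]; exists (sg b a *: x + y).
    by case: sX => _; apply.
  rewrite LD ?LZ ?sgK //; try exact: XE.
  by apply: subspZ => //; apply: XE.
move=> u l uX ul.
have /choice[x xP] n : exists x, X x /\ u n = L x by have [x Xx <-] := uX n; exists x.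
have nL z : E z -> nsq ip (L z) = nsq ip z.
  by move=> Ez; rewrite /nsq Lip // sg_real ?ip_conj.
have xu n m : nsq ip (x n - x m) = nsq ip (u n - u m).
  have [[Xn ->] [Xm ->]] := (xP n, xP m).
  rewrite -(sisoB sE Li) ?nL //; try exact: XE.
  by apply: subspB => //; apply: XE.
have cau : hcauchy ip x.
  apply/(hcauchy_nsq hH) => e e0; have /(hcvg_nsq hH)/(_ (e / 4)) := ul.
  rewrite divr_gt0 // => /(_ isT)[K hK]; exists K => n m Kn Km; rewrite xu.
  have -> : u n - u m = (u n - l) + (l - u m) by rewrite addrA subrK.
  apply: (le_lt_trans (nsq_le2 hH _ _)).
  have := hK _ Kn; have := hK _ Km; rewrite (nsqBC hH (u m)); lra.
have [y xy] : exists y, hcvg ip x y by case: hH => _; apply.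
have Xy : X y by apply: cX xy => n; case: (xP n).
exists y => //; apply/subr0_eq/(nsq_eq0 hH)/eqP.
rewrite eq_le nsq_ge0 // andbT; apply: (@le_of_eps _ _ 4) => e e0.
have /(hcvg_nsq hH)/(_ _ e0)[K1 h1] := ul; have /(hcvg_nsq hH)/(_ _ e0)[K2 h2] := xy.
pose n := maxn K1 K2; have {}h1 := h1 n (leq_maxl _ _); have {}h2 := h2 n (leq_maxr _ _).
have -> : L y - l = (L y - u n) + (u n - l) by rewrite addrA subrK.
apply: (le_trans (nsq_le2 hH _ _)).
have : nsq ip (L y - u n) = nsq ip (x n - y).
  have [Xn ->] := xP n; rewrite -(sisoB sE Li) ?nL 1?nsqBC //; try exact: XE.
  by apply: subspB => //; apply: XE.
lra.
Qed.

End Subspaces.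

(** * Global isometries, images and preimages *)

Section Isometries.
Variables (R : realType) (H : lmodType R[i]) (ip : H -> H -> R[i]).
Hypothesis hH : hilbert_space ip.
Local Notation C := R[i].

Let hip : ip_axioms ip. Proof. by case: hH. Qed.

Lemma subspT : subsp [set: H].
Proof. by []. Qed.

Lemma hnorm_nsq x y : hnorm ip x = hnorm ip y <-> nsq ip x = nsq ip y.
Proof.
split=> [h|]; last by rewrite /hnorm /nsq => ->.
by rewrite -[LHS]sqr_sqrtr ?nsq_ge0 // -[RHS]sqr_sqrtr ?nsq_ge0 // /nsq -/(hnorm ip x) h.
Qed.

(** Polarisation: norms give the real parts of inner products, and replacing [x] by ['i *: x] gives
    the imaginary parts. *)
Lemma lin_isometry_siso M : lin_isometry ip M -> siso ip false setT M.
Proof.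
move=> [MD MZ Mn]; split=> [x y _ _|a x _|x y _ _] //=.
have Mq z : ip (M z) (M z) = ip z z.
  by rewrite !(ip_nsq hH); congr (real_complex _ _); apply/hnorm_nsq.
have re u v : ip (M u) (M v) + ip (M v) (M u) = ip u v + ip v u.
  have := Mq (u + v); rewrite MD !(ipE hip) !Mq => h.
  apply: (addrI (ip u u)); apply: (addIr (ip v v)).
  by move: h; rewrite !addrA.
have h1 := re x y; have := re ('i *: x) y; rewrite MZ !(ipE hip) conjCi => h2.
have i0 : ('i : C) != 0 by rewrite neq0Ci.
have two : (2%:R : C) != 0 by rewrite pnatr_eq0.
apply: (mulfI (mulf_neq0 two i0)).
transitivity ('i * (ip (M x) (M y) + ip (M y) (M x))
    + ('i * ip (M x) (M y) + - 'i * ip (M y) (M x))); first by ring.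
by rewrite h1 h2; ring.
Qed.

Lemma siso_isometry b L : siso ip b setT L -> lin_isometry ip L \/ conjlin_isometry ip L.
Proof.
move=> [LD LZ Li].
have Ln x : hnorm ip (L x) = hnorm ip x.
  by apply/hnorm_nsq; rewrite /nsq Li // sg_real ?ip_conj.
by case: b LZ Li => LZ Li; [right|left]; split=> *; rewrite ?LD ?LZ.
Qed.

Lemma image_subset_inj b (E X Y : set H) L : subsp E -> siso ip b E L ->
  X `<=` E -> Y `<=` E -> L @` X `<=` L @` Y -> X `<=` Y.
Proof.
move=> sE Li XE YE h x Xx; have [|y Yy e] := h (L x); first by exists x.
by rewrite -(siso_inj hip sE Li (YE _ Yy) (XE _ Xx) e).
Qed.

Lemma image_inj b (E X Y : set H) L : subsp E -> siso ip b E L ->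
  X `<=` E -> Y `<=` E -> L @` X = L @` Y -> X = Y.
Proof.
move=> sE Li XE YE h; apply/seteqP; split.
  by apply: (image_subset_inj sE Li XE YE); rewrite h.
by apply: (image_subset_inj sE Li YE XE); rewrite h.
Qed.

Lemma preimage_closed b (E X Y : set H) L : subsp E -> siso ip b E L ->
  X `<=` E -> closed_subspace ip X -> closed_subspace ip Y ->
  closed_subspace ip [set x | X x /\ Y (L x)].
Proof.
move=> sE Li XE [sX cX] [sY cY]; have [LD LZ Lip] := Li; split.
  split; first by rewrite /= (siso0 sE Li); split; [case: sX|case: sY].
  move=> a x y [Xx Yx] [Xy Yy] /=; split; first by case: sX => _; apply.
  rewrite LD ?LZ; try exact: XE; last by apply: subspZ => //; apply: XE.
  by apply: subspD => //; apply: subspZ.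
move=> u l uXY ul.
have Xl : X l by apply: cX ul => n; case: (uXY n).
split=> //; apply: (cY (L \o u)) => [n|]; first by case: (uXY n).
apply/(hcvg_nsq hH) => e e0; have /(hcvg_nsq hH)/(_ _ e0)[K hK] := ul.
exists K => n /hK; have [/XE En _] := uXY n; have El := XE _ Xl.
rewrite /= -(sisoB sE Li) // /nsq Lip ?sg_real ?ip_conj //; exact: subspB.
Qed.

Lemma preimage_idim b (E X Y : set H) L : subsp E -> siso ip b E L ->
  subsp X -> X `<=` E -> Y `<=` L @` X -> infinite_dim Y ->
  infinite_dim [set x | X x /\ Y (L x)].
Proof.
move=> sE Li sX XE YX iY n; have [v [Yv vi]] := iY n.
have /choice[w wP] i : exists x, X x /\ L x = v i by have [x Xx e] := YX _ (Yv i); exists x.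
exists w; split.
  by move=> i; have [Xw Lw] := wP i; split=> //; rewrite Lw.
move=> c c0 i; have [LD LZ _] := Li; suff : sg b (c i) = 0.
  by move=> h; rewrite -[c i](sgK b) h sg0.
apply: (vi (fun i => sg b (c i))).
have Ew j : E (w j) by apply: XE; case: (wP j).
(* Membership in [E] is carried through the sum because [L] is additive only there. *)
pose K (a : H) (y : H) := E a /\ L a = y.
suff [_ <-] : K (\sum_i c i *: w i) (\sum_i sg b (c i) *: v i).
  by rewrite c0; apply: (siso0 sE Li).
apply: (big_ind2 K).
- by split; [case: sE|apply: (siso0 sE Li)].
- by move=> x1 x2 y1 y2 [E1 <-] [E2 <-]; split; [apply: subspD|rewrite LD].
- by move=> j _; split; [apply: subspZ|rewrite LZ // (proj2 (wP j))].
Qed.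

End Isometries.

(** * Rigidity below a subspace *)

Section PairMaps.
Variables (R : realType) (H : lmodType R[i]) (ip : H -> H -> R[i]).
Hypothesis hH : hilbert_space ip.
Local Notation C := R[i].
Local Notation ortho := (ortho ip).
Local Notation G := (Ginf ip).
Local Notation hyp := (hyperplanes ip).

Let hip : ip_axioms ip. Proof. by case: hH. Qed.

Variable f : set H -> set H.
Hypothesis fG : forall X, G X -> G (f X).
Hypothesis f_pairs : forall X Y, G X -> G Y -> equiv_pairs ip X Y (f X) (f Y).

(** Equivalence of unordered pairs leaves a swapped alternative, which must be treated at every
    use. *)
Lemma f_pairsP X Y : G X -> G Y -> exists M, siso ip false setT M /\
  ((f X = M @` X /\ f Y = M @` Y) \/ (f X = M @` Y /\ f Y = M @` X)).
Proof.
move=> GX GY; have [M [/(lin_isometry_siso hH) Mi h]] := f_pairs GX GY.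
by exists M.
Qed.

Lemma isom_sub M X Y : siso ip false setT M -> M @` X `<=` M @` Y -> X `<=` Y.
Proof. by move=> Mi; apply: (image_subset_inj hH (subspT H) Mi). Qed.

Lemma f_inj X Y : G X -> G Y -> f X = f Y -> X = Y.
Proof.
move=> GX GY; have [M [Mi [[-> ->]|[-> ->]]]] := f_pairsP GX GY;
  move/(image_inj hH (subspT H) Mi) => h; [exact: h|apply/esym; exact: h].
Qed.

(** Comparability is symmetric in the pair, so it survives the swap even where the direction of the
    inclusion may not. *)
Lemma f_comparable X Y : G X -> G Y ->
  (X `<=` Y \/ Y `<=` X) <-> (f X `<=` f Y \/ f Y `<=` f X).
Proof.
move=> GX GY; have [M [Mi [[-> ->]|[-> ->]]]] := f_pairsP GX GY; split.
- by case=> h; [left|right]; apply: image_subset.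
- by case=> /(isom_sub Mi); [left|right].
- by case=> h; [right|left]; apply: image_subset.
- by case=> /(isom_sub Mi); [right|left].
Qed.

Definition rigid (L : H -> H) (X : set H) : Prop :=
  forall Y, G Y -> Y `<=` X -> f Y = L @` Y.

(* If f were to reverse the inclusion, f Y would be the image of a subspace of X,
   contradicting injectivity. *)
Lemma rigid_mono b E L X Y : subsp E -> siso ip b E L -> X `<=` E ->
  G X -> G Y -> rigid L X -> X `<=` Y -> f X `<=` f Y.
Proof.
move=> sE Li XE GX GY rX XY.
have [M [Mi [[-> ->]|[fX fY]]]] := f_pairsP GX GY; first exact: image_subset.
have fYX : f Y `<=` L @` X.
  by rewrite -(rX _ GX (@subset_refl _ X)) fX fY; apply: image_subset.
pose Z := [set x | X x /\ f Y (L x)].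
have ZX : Z `<=` X by move=> x [].
have sX := Ginf_subsp GX.
have iZ : infinite_dim Z.
  by apply: (preimage_idim sE Li) => //; case: (fG GY).
have cZ : closed_subspace ip Z.
  by apply: (preimage_closed hH sE Li XE); apply: Ginf_closed => //; apply: fG.
have GZ : G Z.
  apply: (Ginf_sub hH GX cZ _ ZX); apply: (infinite_dim_idim hH) iZ; by case: cZ.
have fZ : f Z = f Y.
  rewrite (rX _ GZ ZX); apply/seteqP; split=> [_ [x [_ ?] <-] //|y Yy].
  by have [x Xx e] := fYX _ Yy; exists x => //; split=> //; rewrite e.
have ZY := f_inj GZ GY fZ.
by rewrite -[Y]ZY; have -> : X = Z by apply/seteqP; split=> //; rewrite ZY.
Qed.

Lemma hyperplane_Ginf X Z : G X -> hyp X Z -> G Z.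
Proof.
by move=> GX /(hyperplanesP hH _ (Ginf_closed GX))[x [_ _ ->]]; apply: Ginf_perp.
Qed.

(** If [f X] lay in [f Y], then [Y] would be comparable with every hyperplane of [X]. Comparing it
    with the hyperplane normal to one of its own vectors forces [Y] to be [X]. *)
Lemma f_sub_of_hyperplanes X Y : f @` hyp X = hyp (f X) -> G X -> G Y ->
  Y `<=` X -> f Y `<=` f X.
Proof.
move=> fX GX GY YX; have cX := Ginf_closed GX; have sX := Ginf_subsp GX.
have hsub Z : hyp X Z -> f Z `<=` f X.
  by move=> hZ; have [] : hyp (f X) (f Z) by rewrite -fX; exists Z.
have [//|XfY] : f Y `<=` f X \/ f X `<=` f Y by apply/(f_comparable GY GX); left.
have [y [Yy y1 _]] := Ginf_idim hH GY [::].
have ny := unit_neq0 hip y1.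
have hZ : hyp X (perp ip X y) by apply: hyperplane_perp => //; apply: YX.
have GZ := hyperplane_Ginf GX hZ.
have [YZ|ZY] : Y `<=` perp ip X y \/ perp ip X y `<=` Y.
  by apply/(f_comparable GY GZ); right; apply: subset_trans XfY; apply: hsub.
  by have [_ /(ip_eq0 hip)] := YZ _ Yy.
have [YE|->//] := hyperplane_max hH cX hZ (Ginf_subsp GY) ZY YX.
by have := Yy; rewrite YE => -[_ /(ip_eq0 hip)].
Qed.

(** Comparability leaves only the reversed inclusion to exclude, and nothing lies strictly between a
    hyperplane and the whole space, on either side of [f]. *)
Lemma f_sub_hyperplane X Y Z : f @` hyp X = hyp (f X) -> G X -> G Y ->
  Y `<=` X -> Y <> X -> hyp X Z -> Y `<=` Z <-> f Y `<=` f Z.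
Proof.
move=> fX GX GY YX nYX hZ; have GZ := hyperplane_Ginf GX hZ.
have cX := Ginf_closed GX.
have hfZ : hyp (f X) (f Z) by rewrite -fX; exists Z.
have fYX := f_sub_of_hyperplanes fX GX GY YX.
split=> h.
  have [//|ZY] : f Y `<=` f Z \/ f Z `<=` f Y by apply/(f_comparable GY GZ); left.
  have [->//|e] := hyperplane_max hH (Ginf_closed (fG GX)) hfZ (Ginf_subsp (fG GY)) ZY fYX.
  by case: nYX; apply: f_inj.
have [//|ZY] : Y `<=` Z \/ Z `<=` Y by apply/(f_comparable GY GZ); left.
by have [->//|] := hyperplane_max hH cX hZ (Ginf_subsp GY) ZY YX.
Qed.

(** A vector in one of [f Y] and the image of [Y] but not the other would be separated by a
    hyperplane. Separation in [f X] uses that every hyperplane there comes from [X]. *)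
Lemma rigid_of_hyperplanes b E L X : subsp E -> siso ip b E L -> X `<=` E ->
  G X -> f @` hyp X = hyp (f X) -> f X = L @` X ->
  (forall Z, hyp X Z -> f Z = L @` Z) -> rigid L X.
Proof.
move=> sE Li XE GX fX fXE fZE Y GY YX.
have [->//|nYX] := pselect (Y = X).
have cX := Ginf_closed GX; have cfX := Ginf_closed (fG GX).
have fYX := f_sub_of_hyperplanes fX GX GY YX.
have sub := f_sub_hyperplane fX GX GY YX nYX.
apply/seteqP; split=> [p fYp|_ [y Yy <-]].
  have : (L @` X) p by rewrite -fXE; apply: fYX.
  move=> [x Xx xp]; exists x => //; apply: contrapT => nYx.
  have [Z [hZ YZ nZx]] := hyperplane_separation hH cX (Ginf_closed GY) YX Xx nYx.
  have /(sub _ hZ)/(_ _ fYp) := YZ; rewrite (fZE _ hZ) => -[z Zz]; rewrite -xp => e.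
  have [_ ZX _] := hZ.
  by case: nZx; rewrite -(siso_inj hip sE Li _ _ e) //; apply: XE => //; apply: ZX.
apply: contrapT => nfY.
have fXy : f X (L y) by rewrite fXE; exists y => //; apply: YX.
have [Z' [hZ' YZ' nZ']] :=
  hyperplane_separation hH cfX (Ginf_closed (fG GY)) fYX fXy nfY.
have : (f @` hyp X) Z' by rewrite fX.
move=> [Z hZ ZE]; move: YZ' nZ'; rewrite -ZE => /(sub _ hZ) YZ; apply.
by rewrite (fZE _ hZ); exists y => //; apply: YZ.
Qed.

End PairMaps.

(** * Two applications of Wigner's theorem *)

Section BaseIsometry.
Variables (R : realType) (H : lmodType R[i]) (ip : H -> H -> R[i]).
Hypothesis hH : hilbert_space ip.
Local Notation C := R[i].
Local Notation G := (Ginf ip).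
Local Notation hyp := (hyperplanes ip).
Local Notation perp := (perp ip).

Let hip : ip_axioms ip. Proof. by case: hH. Qed.

Variable f : set H -> set H.
Hypothesis fG : forall X, G X -> G (f X).
Hypothesis f_pairs : forall X Y, G X -> G Y -> equiv_pairs ip X Y (f X) (f Y).

(** Only the product of the norms has to agree, so the lemma also serves when the isometry exchanges
    the two lines. *)
Lemma norm_ip_prop (x1 x2 y1 y2 : H) a c : x1 = a *: x2 -> y1 = c *: y2 ->
  ip x1 x1 * ip y1 y1 = ip x2 x2 * ip y2 y2 -> `|ip x1 y1| = `|ip x2 y2|.
Proof.
move=> -> ->.
have [->|nx2] := pselect (x2 = 0); first by rewrite scaler0 !(ip0l hip).
have [->|ny2] := pselect (y2 = 0); first by rewrite scaler0 !(ip0r hip).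
rewrite !(ipE hip) => h.
have : `|a * c| ^+ 2 = 1.
  apply: (mulIf (mulf_neq0 (ip_neq0 hip nx2) (ip_neq0 hip ny2))).
  by rewrite mul1r -[RHS]h normCK conjM; ring.
move/eqP; rewrite sqrp_eq1 // => /eqP ac.
by rewrite !normrM norm_conjC mulrA -normrM ac mul1r.
Qed.

Lemma norm_ip_collinear (x y : H) c : y = c *: x -> `|ip x y| ^+ 2 = ip x x * ip y y.
Proof. by move=> ->; rewrite norm2_ip // !(ipE hip); ring. Qed.

Lemma image_perp b (E X : set H) L x : siso ip b E L -> X `<=` E -> E x ->
  L @` perp X x = perp (L @` X) (L x).
Proof.
move=> [_ _ Li] XE Ex; apply/seteqP; split=> [_ [y [Xy xy] <-]|_ [[y Xy <-]]].
  split; first by exists y.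
  by rewrite Li ?xy ?sg0 //; apply: XE.
rewrite Li //; last exact: XE.
by move=> h; exists y => //; split=> //; rewrite -[LHS](sgK b) h sg0.
Qed.

Lemma perp_scale X (x : H) c : c != 0 -> perp X (c *: x) = perp X x.
Proof.
move=> c0; apply/seteqP; split=> y [Xy]; rewrite ?(ipZl hip) => h; split=> //.
  by move/eqP: h; rewrite mulf_eq0 (negbTE c0) => /eqP.
by rewrite (ipZl hip) h mulr0.
Qed.

Lemma prop_neq0 (x y : H) c : x = c *: y -> x <> 0 -> c != 0.
Proof. by move=> -> nx; apply/eqP => c0; apply: nx; rewrite c0 scale0r. Qed.

Variable X0 : set H.
Hypothesis GX0 : G X0.
Hypothesis f_hyp : f @` hyp X0 = hyp (f X0).

Let cX0 := Ginf_closed GX0.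
Let sX0 := Ginf_subsp GX0.
Let cfX0 := Ginf_closed (fG GX0).
Let sfX0 := Ginf_subsp (fG GX0).

(* Hyperplanes of X0 are encoded by normal vectors; f acts on normals up to phase. *)
Lemma normal_exists x : exists y, ip y y = ip x x /\
  (X0 x -> x <> 0 -> f X0 y /\ f (perp X0 x) = perp (f X0) y).
Proof.
have [[Xx nx]|h] := pselect (X0 x /\ x <> 0); last first.
  (* Default value outside the nonzero vectors of [X0], chosen so that the norm identity holds
     everywhere. *)
  by exists x; split=> // Xx nx; case: h.
have GZ := Ginf_perp hH x GX0.
have [M [Mi [[fX fZ]|[fX fZ]]]] := f_pairsP hH f_pairs GX0 GZ.
  exists (M x); split; first by case: Mi => _ _ ->.
  split; first by rewrite fX; exists x.
  by rewrite fZ (image_perp Mi) // fX.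
have hZ : hyp (f X0) (f (perp X0 x)).
  by rewrite -f_hyp; exists (perp X0 x) => //; apply: hyperplane_perp.
have [_ ] := hZ; rewrite fX fZ => /(isom_sub hH Mi)/(_ _ Xx)[_ /(ip_eq0 hip) //].
Qed.

Lemma rigid_base : exists b U, [/\ siso ip b X0 U, f X0 = U @` X0 & rigid ip f U X0].
Proof.
have /choice[phi phiP] := normal_exists.
have phin x : ip (phi x) (phi x) = ip x x by case: (phiP x).
have phin0 x : x <> 0 -> phi x <> 0.
  by move=> nx p0; apply: nx; apply: (ip_eq0 hip); rewrite -phin p0 (ip0l hip).
have phi0 : phi 0 = 0 by apply: (ip_eq0 hip); rewrite phin (ip0l hip).
have phiX x : X0 x -> x <> 0 -> f X0 (phi x) by move=> Xx nx; case: (phiP x) => _ [].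
have phiZ x : X0 x -> x <> 0 -> f (perp X0 x) = perp (f X0) (phi x).
  by move=> Xx nx; case: (phiP x) => _ [].
have angle x w : X0 x -> X0 w -> `|ip (phi x) (phi w)| = `|ip x w|.
  move=> Xx Xw.
  have [->|nx] := pselect (x = 0); first by rewrite phi0 !(ip0l hip).
  have [->|nw] := pselect (w = 0); first by rewrite phi0 !(ip0r hip).
  have hx := hyperplane_perp hH cX0 Xx nx; have hw := hyperplane_perp hH cX0 Xw nw.
  have Gx := Ginf_perp hH x GX0; have Gw := Ginf_perp hH w GX0.
  have [e|ne] := pselect (perp X0 x = perp X0 w).
    have [c wE] : exists c, w = c *: x by apply: (perp_inj hH sX0) => //; rewrite e.
    have [d pE] : exists d, phi w = d *: phi x.
      apply: (perp_inj hH sfX0 (phiX _ Xx nx) (phiX _ Xw nw) (phin0 _ nx)).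
      by rewrite -!phiZ // e.
    apply/eqP; rewrite -(@eqrXn2 _ 2) // (norm_ip_collinear wE) (norm_ip_collinear pE).
    by rewrite !phin.
  have [M [Mi hM]] := f_pairsP hH f_pairs Gx Gw.
  have fsub Z : hyp X0 Z -> f Z `<=` f X0.
    by move=> hZ; have [] : hyp (f X0) (f Z) by rewrite -f_hyp; exists Z.
  have [subx subw] : M @` perp X0 x `<=` f X0 /\ M @` perp X0 w `<=` f X0.
    by case: hM => -[<- <-]; split; apply: fsub.
  (* [M] is known only on the two hyperplanes. They are distinct and both lie in [Y], so [Y] is all
     of [X0] and [M] sends normals into [f X0]. *)
  pose Y := [set y | X0 y /\ f X0 (M y)].
  have [sY _] : closed_subspace ip Y by apply: (preimage_closed hH (subspT H) Mi).
  have YX : Y `<=` X0 by move=> y [].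
  have xY : perp X0 x `<=` Y.
    by move=> y xy; split; [case: xy|apply: subx; exists y].
  have wY : perp X0 w `<=` Y.
    by move=> y wy; split; [case: wy|apply: subw; exists y].
  have YE : Y = X0.
    have [YE|//] := hyperplane_max hH cX0 hx sY xY YX.
    rewrite YE in wY.
    have [e|e] := hyperplane_max hH cX0 hw (Ginf_subsp Gx) wY (@perp_sub _ _ _ _ _).
      by case: ne.
    by have := Xx; rewrite -e => -[_ /(ip_eq0 hip)].
  have XM y : X0 y -> f X0 (M y) by rewrite -{1}YE => -[].
  have [_ _ Mip] := Mi.
  have sub_perp y : X0 y -> M @` perp X0 y `<=` perp (f X0) (M y).
    move=> Xy _ [z [Xz yz] <-]; split; first exact: XM.
    by rewrite Mip.
  have key y z : X0 y -> X0 z -> z <> 0 -> f (perp X0 z) = M @` perp X0 y ->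
      exists c, M y = c *: phi z.
    move=> Xy Xz nz e; apply: (perp_inj hH sfX0) => //; [exact: phiX|exact: XM|exact: phin0|].
    by rewrite -phiZ // e; apply: sub_perp.
  have Mxw : ip (M x) (M w) = ip x w by rewrite Mip.
  case: hM => -[ex ew].
    have [c xE] := key _ _ Xx Xx nx ex; have [d wE] := key _ _ Xw Xw nw ew.
    by rewrite -Mxw; apply/esym/(norm_ip_prop xE wE); rewrite !Mip // !phin.
  have [c xE] := key _ _ Xx Xw nw ew; have [d wE] := key _ _ Xw Xx nx ex.
  have := norm_ip_prop xE wE; rewrite Mxw (ipC hip (phi x) (phi w)) norm_conjC => -> //.
  by rewrite !Mip //= !phin mulrC.
have [b [U [Ui UP]]] := wigner hip sX0 angle.
have [UD UZ Uip] := Ui.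
have Un0 x : X0 x -> x <> 0 -> U x <> 0.
  move=> Xx nx U0; apply: nx; apply: (ip_eq0 hip).
  by have := Uip _ _ Xx Xx; rewrite U0 (ip0l hip) sg_real ?ip_conj.
have UX x : X0 x -> f X0 (U x).
  move=> Xx; have [->|nx] := pselect (x = 0).
    by rewrite (siso0 sX0 Ui); case: sfX0.
  by have [c ->] := UP _ Xx; apply: subspZ => //; apply: phiX.
(* Surjectivity of [f] on hyperplanes makes every nonzero [p] in [f X0] proportional to some
   [phi x], hence to [U x]. *)
have fXE : f X0 = U @` X0.
  apply/seteqP; split=> [p fp|_ [x Xx <-]]; last exact: UX.
  have [->|np] := pselect (p = 0); first by exists 0; [case: sX0|apply: (siso0 sX0 Ui)].
  have : (f @` hyp X0) (perp (f X0) p) by rewrite f_hyp; apply: hyperplane_perp.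
  move=> [_ /(hyperplanesP hH _ cX0)[x [Xx nx ->]]]; rewrite phiZ // => e.
  have [c pE] : exists c, p = c *: phi x.
    by apply: (perp_inj hH sfX0) => //; [exact: phiX|exact: phin0|rewrite e].
  have [d UE] := UP _ Xx; have pE' := prop_sym (Un0 _ Xx nx) UE.
  exists (sg b (c * d^-1) *: x); first exact: subspZ.
  by rewrite UZ // sgK pE pE' scalerA.
exists b, U; split=> //.
apply: (rigid_of_hyperplanes hH fG f_pairs sX0 Ui) => // Z.
move=> /(hyperplanesP hH _ cX0)[x [Xx nx ->]].
rewrite phiZ // (image_perp Ui) // -fXE.
have [c UE] := UP _ Xx; rewrite UE perp_scale //.
exact: prop_neq0 UE (Un0 _ Xx nx).
Qed.

End BaseIsometry.

(** * Extending the isometry from [X0] to the whole space *)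

Section Extension.
Variables (R : realType) (H : lmodType R[i]) (ip : H -> H -> R[i]).
Hypothesis hH : hilbert_space ip.
Local Notation C := R[i].
Local Notation G := (Ginf ip).
Local Notation ortho := (ortho ip).

Let hip : ip_axioms ip. Proof. by case: hH. Qed.

Lemma addl0 (X : set H) : addl X 0 = X.
Proof.
apply/seteqP; split=> [_ [a [t [Xt ->]]]|]; first by rewrite scaler0 addr0.
exact: addl_sub.
Qed.

Lemma addl_scale (X : set H) v c : c != 0 -> addl X (c *: v) = addl X v.
Proof.
move=> c0; apply/seteqP; split=> _ [a [t [Xt ->]]].
  by exists (a * c), t; rewrite scalerA.
by exists (a / c), t; rewrite scalerA divfK.
Qed.

Lemma addl_ortho (X : set H) p q : subsp X -> ortho X p -> ortho X q ->
  addl X q p -> exists a, p = a *: q.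
Proof.
move=> sX Xp Xq [a [t [Xt pE]]]; exists a.
suff t0 : t = 0 by rewrite pE t0 add0r.
apply: (ortho_self hH Xt).
have -> : t = p - a *: q by rewrite pE addrK.
have [sO _] := ortho_closed hH X.
by apply: (subspB sO) => //; apply: (subspZ _ sO).
Qed.

Lemma image_addl b (E X : set H) L v : subsp E -> siso ip b E L -> X `<=` E -> E v ->
  L @` addl X v = addl (L @` X) (L v).
Proof.
move=> sE [LD LZ _] XE Ev; apply/seteqP; split=> [_ [_ [a [t [Xt ->]]] <-]|].
  exists (sg b a), (L t); split; first by exists t.
  by rewrite LD ?LZ //; [exact: XE|exact: subspZ].
move=> _ [a [_ [[t Xt <-] ->]]]; exists (t + sg b a *: v); first by exists (sg b a), t.
by rewrite LD ?LZ ?sgK //; [exact: XE|exact: subspZ].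
Qed.

Lemma siso_scale b (E : set H) L c : c * c^* = 1 -> siso ip b E L ->
  siso ip b E (fun x => c *: L x).
Proof.
move=> c1 [LD LZ Li]; split=> [x y Ex Ey|a x Ex|x y Ex Ey].
- by rewrite LD // scalerDr.
- by rewrite LZ // !scalerA mulrC.
- by rewrite !(ipE hip) Li // mulrA c1 mul1r.
Qed.

Variable f : set H -> set H.
Hypothesis fG : forall X, G X -> G (f X).
Hypothesis f_pairs : forall X Y, G X -> G Y -> equiv_pairs ip X Y (f X) (f Y).
Variables (X0 : set H) (b : bool) (U : H -> H).
Hypothesis GX0 : G X0.
Hypothesis Ui : siso ip b X0 U.
Hypothesis Urigid : rigid ip f U X0.

Let sX0 := Ginf_subsp GX0.

Section Fixed.
Variable T : set H.
Hypotheses (GT : G T) (TX0 : T `<=` X0) (iT : idim ip (X0 `&` ortho T)).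

Let sT := Ginf_subsp GT.
Let sfT := Ginf_subsp (fG GT).

Lemma image_T : f T = U @` T.
Proof. exact: Urigid. Qed.

Lemma f_addl_sub v : f T `<=` f (addl T v).
Proof.
apply: (rigid_mono hH fG f_pairs sX0 Ui TX0 GT) => //; first exact: Ginf_addl.
  by move=> Y GY YT; apply: Urigid => //; apply: subset_trans TX0.
exact: addl_sub.
Qed.

(* One-dimensional extensions of T are encoded by their directions orthogonal to T. *)
Lemma direction_exists v : exists y, ip y y = ip v v /\
  (ortho T v -> ortho (f T) y /\ f (addl T v) = addl (f T) y).
Proof.
have [->|nv] := pselect (v = 0).
  exists 0; split=> // _; rewrite !addl0; split=> // x _; exact: ip0r.
have [Tv|nTv] := pselect (ortho T v); last by exists v.
have [M [Mi [[fT fTv]|[fT fTv]]]] := f_pairsP hH f_pairs GT (Ginf_addl hH v GT).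
  exists (M v); split; first by case: Mi => _ _ ->.
  split; last by rewrite fTv (image_addl (subspT H) Mi) // -fT.
  by rewrite fT => _ [t Tt <-]; case: Mi => _ _ -> //; rewrite Tv.
have := @f_addl_sub v; rewrite fT fTv => /(isom_sub hH Mi)/(_ v (addl_v _ sT)) Tv'.
by case: nv; apply: (ortho_self hH Tv' Tv).
Qed.

Variable phi : H -> H.
Hypothesis phiP : forall v, ip (phi v) (phi v) = ip v v /\
  (ortho T v -> ortho (f T) (phi v) /\ f (addl T v) = addl (f T) (phi v)).

Lemma phi_norm v : ip (phi v) (phi v) = ip v v.
Proof. by case: (phiP v). Qed.

Lemma phi_ortho v : ortho T v -> ortho (f T) (phi v).
Proof. by case: (phiP v) => _ h /h[]. Qed.

Lemma phi_addl v : ortho T v -> f (addl T v) = addl (f T) (phi v).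
Proof. by case: (phiP v) => _ h /h[]. Qed.

Lemma phi_0 : phi 0 = 0.
Proof. by apply: (ip_eq0 hip); rewrite phi_norm (ip0l hip). Qed.

Lemma phi_angle v w : ortho T v -> ortho T w -> `|ip (phi v) (phi w)| = `|ip v w|.
Proof.
move=> Tv Tw.
have [->|nv] := pselect (v = 0); first by rewrite phi_0 !(ip0l hip).
have [->|nw] := pselect (w = 0); first by rewrite phi_0 !(ip0r hip).
have [e|ne] := pselect (addl T v = addl T w).
  have [c wE] : exists c, w = c *: v.
    by apply: (addl_ortho sT Tw Tv); rewrite e; apply: addl_v.
  have [d pE] : exists d, phi w = d *: phi v.
    apply: (addl_ortho sfT (phi_ortho Tw) (phi_ortho Tv)).
    by rewrite -phi_addl // e phi_addl //; apply: addl_v.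
  apply/eqP; rewrite -(@eqrXn2 _ 2) // (norm_ip_collinear hH wE) (norm_ip_collinear hH pE).
  by rewrite !phi_norm.
have Gv := Ginf_addl hH v GT; have Gw := Ginf_addl hH w GT.
have [M [Mi hM]] := f_pairsP hH f_pairs Gv Gw.
have [_ _ Mip] := Mi.
(* [f T] lies in the images under [M] of both extensions; these are distinct, so they meet only in
   [T]. *)
have TM : f T `<=` M @` T.
  move=> p fp.
  have [x [y [Tx Ty xp yp]]] : exists x y, [/\ addl T v x, addl T w y, M x = p & M y = p].
    have := @f_addl_sub v _ fp; have := @f_addl_sub w _ fp.
    by case: hM => -[-> ->] [x Tx xp] [y Ty yp]; [exists y, x|exists x, y].
  have xy : x = y by apply: (siso_inj hip (subspT H) Mi) => //; rewrite xp yp.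
  exists x => //; rewrite -xy in Ty; move: Tx Ty => [a [t [Tt xE]]] [c [s [Ts xE']]].
  have [a0|an] := eqVneq a 0; first by rewrite xE a0 scale0r addr0.
  have [d avE] : exists d, a *: v = d *: w.
    have [sO _] := ortho_closed hH T.
    apply: (addl_ortho sT) => //; first exact: (subspZ _ sO).
    exists c, (s - t); split; first exact: subspB.
    by rewrite addrAC -xE' xE addrC addKr.
  have dn : d != 0.
    apply/eqP => d0; move/eqP: avE; rewrite d0 scale0r scaler_eq0 (negbTE an) /=.
    by move/eqP.
  by case: ne; rewrite -(addl_scale _ v an) avE addl_scale.
have key x y : ortho T x -> ortho T y -> f (addl T y) = M @` addl T x ->
    exists c, M x = c *: phi y.
  move=> Tx Ty e; apply: (addl_ortho sfT); last first.
  - by rewrite -phi_addl // e; exists x => //; apply: addl_v.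
  - exact: phi_ortho.
  - by move=> p /TM[t Tt <-]; rewrite Mip //= Tx.
have Mvw : ip (M v) (M w) = ip v w by rewrite Mip.
case: hM => -[ev ew].
  have [c vE] := key _ _ Tv Tv ev; have [d wE] := key _ _ Tw Tw ew.
  by rewrite -Mvw; apply/esym/(norm_ip_prop hH vE wE); rewrite !Mip // !phi_norm.
have [c vE] := key _ _ Tv Tw ew; have [d wE] := key _ _ Tw Tv ev.
have := norm_ip_prop hH vE wE; rewrite Mvw (ipC hip (phi v) (phi w)) norm_conjC => -> //.
by rewrite !Mip //= !phi_norm mulrC.
Qed.

Lemma extension_at : exists L, [/\ siso ip b setT L, forall x, X0 x -> L x = U x
  & forall v, f (addl T v) = L @` addl T v].
Proof.
have [sO _] := ortho_closed hH T; have cT := Ginf_closed GT.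
have [b' [V0 [V0i V0P]]] := wigner hip sO phi_angle.
have [UD UZ Uip] := Ui.
pose E := X0 `&` ortho T.
have EX0 : E `<=` X0 by move=> ? [].
have EO : E `<=` ortho T by move=> ? [].
have sE : subsp E by case: (closedI (Ginf_closed GX0) (ortho_closed hH T)).
have phin0 v : v <> 0 -> phi v <> 0.
  by move=> nv p0; apply: nv; apply: (ip_eq0 hip); rewrite -phi_norm p0 (ip0l hip).
(* On [X0] within [ortho T], rigidity and [phi] both compute [f (addl T x)], so [U x] and [phi x]
   span the same line modulo [f T]. *)
have UV x : E x -> exists c, U x = c *: V0 x.
  move=> [Xx Tx]; have [->|nx] := pselect (x = 0).
    by exists 0; rewrite scale0r (siso0 sX0 Ui).
  have [a UE] : exists a, U x = a *: phi x.
    apply: (addl_ortho sfT) => //; last first.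
    - rewrite -phi_addl // Urigid; first by exists x => //; apply: addl_v.
        exact: Ginf_addl.
      exact: addl_min.
    - exact: phi_ortho.
    - by rewrite image_T => _ [t Tt <-]; rewrite Uip ?Tx ?sg0 //; apply: TX0.
  have [c VE] := V0P _ Tx.
  have nV : V0 x <> 0.
    move=> V00; apply: nx; apply: (ip_eq0 hip); case: V0i => _ _ /(_ _ _ Tx Tx).
    by rewrite V00 (ip0l hip) sg_real ?ip_conj.
  by exists (a * c^-1); rewrite UE (prop_sym nV VE) scalerA.
have [e [Ee e1 _]] := iT [::]; have [g [Eg g1 ge]] := iT [:: e].
have eg : ip e g = 0 by apply: (ipC0 hip); apply: ge; rewrite mem_head.
have [bb [c [c1 UVc]]] := siso_prop hip sE (siso_sub EX0 Ui) (siso_sub EO V0i) UV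
  Ee Eg (unit_neq0 hip e1) (unit_neq0 hip g1) eg.
(* Adjusting the phase makes [V] agree with [U] on the overlap [E], so that the two pieces glue to
   an extension of [U]. *)
pose V x := c *: V0 x.
have Vi : siso ip b (ortho T) V by rewrite bb; apply: siso_scale.
have [VD VZ Vip] := Vi.
have VP x : ortho T x -> exists a, V x = a *: phi x.
  by move=> /V0P[a VE]; exists (c * a); rewrite /V VE scalerA.
have /choice[P PP] h : exists p, T p /\ ortho T (h - p).
  have [p [q [Tp Tq ->]]] := projection hH h cT; exists p; split=> //.
  by rewrite addrC addKr.
have TP h : T (P h) by case: (PP h).
have OP h : ortho T (h - P h) by case: (PP h).
have Pu p q : T p -> ortho T q -> P (p + q) = p.
  move=> Tp Tq; apply/subr0_eq; apply: (ortho_self hH (X := T)); first exact: subspB.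
  have -> : P (p + q) - p = q - (p + q - P (p + q)).
    by rewrite opprD opprK addrA opprD addrA (addrC q) addrK addrC.
  exact: (subspB sO).
have PD x y : P (x + y) = P x + P y.
  have -> : x + y = (P x + P y) + ((x - P x) + (y - P y)).
    by rewrite addrACA ![P _ + _]addrC !subrK.
  by apply: Pu; [apply: (subspD sT)|apply: (subspD sO)].
have PZ a x : P (a *: x) = a *: P x.
  have -> : a *: x = a *: P x + a *: (x - P x) by rewrite -scalerDr addrC subrK.
  by apply: Pu; [apply: (subspZ _ sT)|apply: (subspZ _ sO)].
have XP h : X0 (P h) by apply: TX0.
have cross x y : ip (U (P x)) (V (y - P y)) = 0.
  have [a ->] := VP _ (OP y).
  rewrite (ipZr hip) (phi_ortho (OP y)) ?mulr0 // image_T; by exists (P x).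
pose L h := U (P h) + V (h - P h).
have LT t : T t -> L t = U t.
  move=> Tt; have Pt : P t = t by rewrite -[t]addr0 Pu //; [rewrite addr0|case: sO].
  by rewrite /L Pt subrr (siso0 sO Vi) addr0.
have LO q : ortho T q -> L q = V q.
  move=> Tq; have Pq : P q = 0 by rewrite -[q]add0r Pu //; case: sT.
  by rewrite /L Pq subr0 (siso0 sX0 Ui) add0r.
have Li : siso ip b setT L.
  split=> [x y _ _|a x _|x y _ _].
  - rewrite /L PD UD // addrACA -VD //; congr (_ + V _).
    by rewrite opprD addrACA.
  - by rewrite /L PZ UZ // -scalerBr VZ // scalerDr.
  - rewrite /L (ipDl hip) !(ipDr hip) cross (ipC0 hip (cross _ _)) addr0 add0r.
    rewrite Uip // Vip // -sgD; congr (sg b _).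
    have -> : ip x y = ip (P x + (x - P x)) (P y + (y - P y)).
      by rewrite !(addrC (P _)) !subrK.
    move: (x - P x) (OP x) (y - P y) (OP y) => qx Ox qy Oy.
    by rewrite !(ipE hip) (Oy (P x)) // (ipC0 hip (Ox _ (TP y))) addr0 add0r.
exists L; split=> // [x Xx|v].
  have Xq : X0 (x - P x) by apply: subspB.
  by rewrite /L /V -UVc // -UD // addrC subrK.
have [p [q [Tp Tq ->]]] := projection hH v cT.
rewrite addl_shift // phi_addl // (image_addl (subspT H) Li) //.
have -> : L @` T = f T.
  by rewrite image_T; apply/seteqP; split=> _ [t Tt <-]; exists t => //; rewrite LT.
rewrite LO //; have [->|nq] := pselect (q = 0); first by rewrite phi_0 (siso0 sO Vi).
have [a aE] := VP _ Tq; rewrite aE addl_scale //; apply/eqP => a0.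
apply: nq; apply: (ip_eq0 hip); have := Vip _ _ Tq Tq.
by rewrite aE a0 scale0r (ip0l hip) sg_real ?ip_conj.
Qed.

End Fixed.

Definition extends (T : set H) (L : H -> H) : Prop :=
  [/\ siso ip b setT L, forall x, X0 x -> L x = U x
    & forall v, f (addl T v) = L @` addl T v].

Lemma extension_exists T : G T -> T `<=` X0 -> idim ip (X0 `&` ortho T) ->
  exists L, extends T L.
Proof.
move=> GT TX0 iT; have /choice[phi phiP] := direction_exists GT TX0.
exact: extension_at phiP.
Qed.

(** For [y] orthogonal to [T], [L' y] lies in the image under [L] of [addl T y] and is orthogonal to
    that of [T], so it is a multiple of [L y]. Agreement with [U] on [X0] fixes the phase to 1, so
    one isometry serves all [T'] below [T]. *)
Lemma extension_unique T T' L L' : G T -> G T' -> T' `<=` T -> T `<=` X0 ->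
  idim ip (X0 `&` ortho T) -> extends T L -> extends T' L' -> L' = L.
Proof.
move=> GT GT' T'T TX0 iT [Li LU fL] [L'i L'U fL'].
have [LD LZ Lip] := Li; have [L'D L'Z L'ip] := L'i.
have sT := Ginf_subsp GT; have sT' := Ginf_subsp GT'.
have T'X0 := subset_trans T'T TX0.
have prop y : ortho T y -> exists a, L' y = a *: L y.
  move=> Ty.
  have sub : f (addl T' y) `<=` f (addl T y).
    have [//|h] : f (addl T' y) `<=` f (addl T y) \/ f (addl T y) `<=` f (addl T' y).
      apply/(f_comparable hH f_pairs (Ginf_addl hH y GT') (Ginf_addl hH y GT)); left.
      exact: addl_mono.
    (* Under the reversed inclusion each [t] in [T] lies in [addl T' y], and orthogonality of [y] to
       [T] then puts it in [T']. *)
    suff -> : T' = T by [].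
    apply/seteqP; split=> // t Tt.
    have : f (addl T' y) (L t) by apply: h; rewrite fL; exists t => //; apply: addl_sub.
    rewrite fL' LU -?L'U; [|exact: TX0|exact: TX0].
    move=> [_ [a [s [T's ->]]] /(siso_inj hip (subspT H) L'i) e].
    have {}e : t - s = a *: y by rewrite -e // addrC addKr.
    have st0 : t - s = 0.
      apply: (ortho_self hH (X := T)); first by apply: subspB => //; apply: T'T.
      by rewrite e; apply: subspZ _ (proj1 (ortho_closed hH T)) Ty.
    by rewrite (subr0_eq st0).
  have : f (addl T y) (L' y) by apply: sub; rewrite fL'; exists y => //; apply: addl_v.
  rewrite fL (image_addl (subspT H) Li) // => -[a [_ [[t Tt <-] e]]].
  exists a; suff t0 : L t = 0 by rewrite e t0 add0r.
  apply: (ip_eq0 hip).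
  have : ip (L' y) (L t) = 0.
    by rewrite LU -?L'U ?L'ip ?(ipC0 hip (Ty _ Tt)) ?sg0 //; apply: TX0.
  rewrite e (ipDl hip) (ipZl hip) (Lip y) // (ipC0 hip (Ty _ Tt)) sg0 mulr0 addr0.
  done.
have [e [[Xe Te] e1 _]] := iT [::]; have [g [[Xg Tg] g1 ge]] := iT [:: e].
have eg : ip e g = 0 by apply: (ipC0 hip); apply: ge; rewrite mem_head.
have [sO _] := ortho_closed hH T.
have OT : ortho T `<=` setT by [].
have [_ [c [c1 hc]]] := siso_prop hip sO (siso_sub OT L'i) (siso_sub OT Li) prop
  Te Tg (unit_neq0 hip e1) (unit_neq0 hip g1) eg.
have Ue0 : L e <> 0.
  move=> Le; apply: (unit_neq0 hip e1); apply: (ip_eq0 hip); have := Lip e e I I.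
  by rewrite Le (ip0l hip) sg_real ?ip_conj.
have cE : c = 1.
  have := hc _ Te; rewrite L'U // -LU // => /eqP.
  rewrite -subr_eq0 -{1}[L e]scale1r -scalerBl scaler_eq0 => /orP[|/eqP //].
  by rewrite subr_eq0 => /eqP.
apply/funext => h; have [p [q [Tp Tq ->]]] := projection hH h (Ginf_closed GT).
by rewrite LD // L'D // (hc q Tq) cE scale1r (LU p) ?(L'U p) //; apply: TX0.
Qed.

(** Quantifying over all [T'] below [T] allows later use of intersections with [T]. *)
Definition base (L : H -> H) (T : set H) : Prop := G T /\
  forall T', G T' -> T' `<=` T -> forall v, f (addl T' v) = L @` addl T' v.

(** Even-indexed vectors of an orthonormal sequence in [X0] span [T]; the odd ones leave
    infinite-dimensional room in [X0] orthogonal to [T]. *)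
Lemma base_exists : exists L T, siso ip b setT L /\ base L T.
Proof.
have iX0 := Ginf_idim hH GX0.
have [e [eX eo]] := @idim_orthonormal _ _ _ hH (fun=> X0) (fun=> iX0).
pose T := clspan ip [set e n.*2 | n in setT].
have cT : closed_subspace ip T := clspan_closed hH _.
have TX0 : T `<=` X0.
  by apply: (clspan_min hH (Ginf_closed GX0)) => _ [n _ <-].
have iT : idim ip T.
  apply: (@subsequence_idim _ _ _ hH _ e double) => // [|n m|n]; first by case: cT.
    by lia.
  by apply: (clspan_sub hH); exists n.
have iO : idim ip (X0 `&` ortho T).
  apply: (@subsequence_idim _ _ _ hH _ e (fun n => n.*2.+1)) => // [|n m|n].
  - by case: (closedI (Ginf_closed GX0) (ortho_closed hH T)).
  - by lia.
  - split=> //; apply: (ortho_clspan hH) => _ [m _ <-]; rewrite eo.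
    by rewrite (_ : (_ == _) = false) //; apply/eqP; lia.
have GT : G T by apply: Ginf_sub GX0 _ _ TX0.
have [L LT] := extension_exists GT TX0 iO.
exists L, T; split; first by case: LT.
split=> // T' GT' T'T v.
have T'X0 := subset_trans T'T TX0.
have iO' : idim ip (X0 `&` ortho T').
  apply: idim_sub iO => x [Xx Tx]; split=> //; exact: ortho_anti Tx.
have [L' LT'] := extension_exists GT' T'X0 iO'.
have <- := extension_unique GT GT' T'T TX0 iO LT LT'.
by case: LT'.
Qed.

End Extension.

(** * From a base subspace to all of G_infty *)

Section Propagation.
Variables (R : realType) (H : lmodType R[i]) (ip : H -> H -> R[i]).
Hypothesis hH : hilbert_space ip.
Local Notation C := R[i].
Local Notation G := (Ginf ip).
Local Notation hyp := (hyperplanes ip).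
Local Notation ortho := (ortho ip).

Let hip : ip_axioms ip. Proof. by case: hH. Qed.

(** Totality means that no nonzero vector of [Y] is orthogonal to the family, so no series has to be
    summed. Only the even terms are placed in [T], since [Y] itself need not lie there. *)
Lemma orthonormal_basis Y T : hseparable ip -> closed_subspace ip Y -> idim ip Y ->
  idim ip (Y `&` T) -> exists y : nat -> H,
  [/\ forall n, Y (y n), forall n, T (y n.*2),
      forall n m, ip (y n) (y m) = (n == m)%:R
    & forall x, Y x -> (forall n, ip (y n) x = 0) -> x = 0].
Proof.
move=> [d dP] cY iY iYT.
pose Q s x := [/\ Y x, ~~ odd (size s) -> T x
  & odd (size s) -> forall z, Y z -> (forall v, v \in s -> ip v z = 0) ->
      ip x z = 0 -> ip (d (size s)./2) z = 0].
(* Odd steps absorb the dense sequence, which makes the family total; even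
   steps stay inside T. *)
have Qex s : exists x, [/\ Q s x, ip x x = 1 & forall v, v \in s -> ip x v = 0].
  have [os|es] := boolP (odd (size s)); last first.
    have [x [[Yx Tx] x1 xs]] := iYT s; exists x; split=> //; split=> //.
    by rewrite (negbTE es).
  (* The new vector is the normalised component of the dense vector in [Ys]; if that component is
     zero, any admissible unit vector will do. *)
  pose Ys := Y `&` ortho [set v | v \in s].
  have cYs : closed_subspace ip Ys by apply: closedI => //; apply: (ortho_closed hH).
  have [q [q' [[Yq sq] Yq' dE]]] := projection hH (d (size s)./2) cYs.
  have [q0|nq] := pselect (q = 0).
    have [x [Yx x1 xs]] := iY s; exists x.
    split=> //; split=> // [|_ z Yz sz _]; first by rewrite os.
    by rewrite dE q0 add0r; apply: (ipC0 hip); apply: Yq'.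
  have [c c1] := unit_vector hH nq; exists (c *: q); split=> //.
    have [sY _] := cY; split=> //; first exact: subspZ.
      by rewrite os.
    move=> _ z Yz sz xz; rewrite dE (ipDl hip).
    rewrite (ipC0 hip (Yq' z _)) // addr0.
    have c0 : c != 0.
      by apply/eqP => c0; move/eqP: c1; rewrite c0 scale0r (ip0l hip) eq_sym oner_eq0.
    by move/eqP: xz; rewrite (ipZl hip) mulf_eq0 (negbTE c0) => /eqP.
  by move=> v vs; rewrite (ipZl hip) (ipC0 hip (sq _ vs)) mulr0.
have [y [yQ yo]] := orthonormal_choice hH Qex.
exists y; split=> // [n|n|x Yx yx]; first by case: (yQ n).
  by case: (yQ n.*2) => _ + _; rewrite size_map size_iota odd_double; apply.
have dx k : ip (d k) x = 0.
  have ok : odd k.*2.+1 by rewrite oddS odd_double.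
  have hk : (k.*2.+1)./2 = k by rewrite -[LHS]/(uphalf k.*2) uphalf_double.
  case: (yQ k.*2.+1) => _ _; rewrite size_map size_iota hk => /(_ ok) h.
  by apply: h => // v /mapP[n _ ->].
apply: (ip_eq0 hip); apply: csq_eq0; apply/eqP.
rewrite eq_le csq_ge0 andbT; apply: (@le_of_eps _ _ (nsq ip x)) => e e0.
have [|n] := dP x (Num.sqrt e); first by rewrite sqrtr_gt0.
rewrite (hnorm_lt hH) ?sqrtr_gt0 // sqr_sqrtr; last exact: ltW. 
move=> xd.
have -> : ip x x = ip (x - d n) x by rewrite (ipBl hip) dx subr0.
apply: (le_trans (cauchy_schwarz_real hH _ _)).
by rewrite ler_wpM2r ?nsq_ge0 // ltW.
Qed.

(** Each [x n] is orthogonal to every [p k] but [p n], hence a nonzero multiple of [p n] by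
    totality; so [L] contains the total family. *)
Lemma sub_of_orthogonal_total (X L : set H) (x p : nat -> H) :
  closed_subspace ip L -> subsp X -> L `<=` X ->
  (forall n, L (x n)) -> (forall n, x n <> 0) -> (forall n, X (p n)) ->
  (forall n m, n <> m -> ip (p n) (p m) = 0) ->
  (forall n, ip (p n) (p n) != 0) ->
  (forall z, X z -> (forall n, ip (p n) z = 0) -> z = 0) ->
  (forall n k, n <> k -> ip (x n) (p k) = 0) -> X `<=` L.
Proof.
move=> cL sX LX Lx nx Xp po pn ptot xp.
have Lp n : L (p n).
  pose c := ip (x n) (p n) / ip (p n) (p n).
  have xE : x n = c *: p n.
    apply/subr0_eq/ptot => [|k]; first by apply: subspB => //; [exact: LX|exact: subspZ].
    rewrite (ipBr hip) (ipZr hip); have [->|/eqP kn] := eqVneq k n.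
      rewrite /c conjM conjV (ip_conj hip) -(ipC hip (x n)) divfK ?subrr //.
    by rewrite (ipC0 hip (xp n k _)) ?po ?mulr0 ?subrr // => e; apply: kn.
  by rewrite (prop_sym (nx n) xE); apply: subspZ => //; case: cL.
move=> z Xz; have [v [r [Lv Lr zE]]] := projection hH z cL.
suff r0 : r = 0 by rewrite zE r0 addr0.
apply: ptot => [|n]; last by apply: Lr.
have -> : r = z - v by rewrite zE addrC addKr.
by apply: subspB => //; apply: LX.
Qed.

Variable f : set H -> set H.
Hypothesis fG : forall X, G X -> G (f X).
Hypothesis f_pairs : forall X Y, G X -> G Y -> equiv_pairs ip X Y (f X) (f Y).
Variables (b : bool) (L : H -> H).
Hypothesis Li : siso ip b setT L.

Local Notation base := (base ip f L).

Let LD x y : L (x + y) = L x + L y. Proof. by case: Li => h _ _; apply: h. Qed.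
Let LZ a x : L (a *: x) = sg b a *: L x. Proof. by case: Li => _ h _; apply: h. Qed.
Let Lip x y : ip (L x) (L y) = sg b (ip x y). Proof. by case: Li => _ _; apply. Qed.

Lemma image_subsp X : subsp X -> subsp (L @` X).
Proof.
move=> sX; split; first by exists 0; [case: sX|apply: (siso0 (subspT H) Li)].
move=> a _ _ [x Xx <-] [y Xy <-]; exists (sg b a *: x + y).
  by case: sX => _; apply.
by rewrite LD LZ sgK.
Qed.

Lemma L_neq0 x : x <> 0 -> L x <> 0.
Proof.
move=> nx e; apply: nx; apply: (ip_eq0 hip); have := Lip x x.
by rewrite e (ip0l hip) sg_real ?ip_conj.
Qed.

Lemma base_eq T T' : base T -> G T' -> T' `<=` T -> f T' = L @` T'.
Proof. by move=> [_ h] GT' T'T; have := h _ GT' T'T 0; rewrite addl0. Qed.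

(** A [Z] not inside [T'] is its intersection with [T'] plus one line; that intersection is still
    infinite-dimensional, so the definition of a base applies to it. *)
Lemma base_rigid T T' v : base T -> G T' -> T' `<=` T -> rigid ip f L (addl T' v).
Proof.
move=> bT GT' T'T Z GZ; have sT' := Ginf_subsp GT'; have sZ := Ginf_subsp GZ.
have [p [q [Tp Tq ->]]] := projection hH v (Ginf_closed GT'); rewrite addl_shift // => ZT.
have [ZT'|] := pselect (Z `<=` T').
  by apply: base_eq bT GZ _; apply: subset_trans T'T.
move=> /existsNP[z /not_implyP[Zz nT'z]].
pose S := Z `&` T'.
have ST' : S `<=` T' by move=> ? [].
have iS : idim ip S.
  apply: idim_sub (idim_perp hH q (Ginf_idim hH GZ)) => w [Zw qw]; split=> //.
  have [a [t [Tt wE]]] := ZT _ Zw.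
  move: qw; rewrite wE (ipDr hip) (ipC0 hip (Tq _ Tt)) add0r (ipZr hip) => /eqP.
  rewrite mulf_eq0 => /orP[/eqP a0|/eqP/(ip_eq0 hip) ->].
    by rewrite -[a]conjCK a0 conjC0 scale0r addr0.
  by rewrite scaler0 addr0.
have GS : G S.
  apply: (Ginf_sub hH GT' _ iS ST'); apply: closedI; exact: Ginf_closed.
have [a0 [t0 [Tt0 zE]]] := ZT _ Zz.
have a0n : a0 != 0 by apply/eqP => e; apply: nT'z; rewrite zE e scale0r addr0.
have -> : Z = addl S z.
  apply/seteqP; split; last by apply: addl_min => // ? [].
  move=> w Zw; have [a [t [Tt wE]]] := ZT _ Zw.
  exists (a / a0), (w - (a / a0) *: z); split; last by rewrite subrK.
  split; first by apply: subspB => //; apply: subspZ.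
  rewrite wE zE scalerDr scalerA divfK // opprD addrA addrAC addrK.
  by apply: subspB => //; apply: subspZ.
by case: bT => _; apply=> //; apply: subset_trans T'T.
Qed.

(** Both bounds compare [Y] with one-dimensional extensions of [Y] intersected with [T], on which
    [f] is already known. *)
Lemma base_bounds T Y : base T -> G Y -> idim ip (Y `&` T) ->
  (forall y, Y y -> f Y (L y)) /\ (forall w, ortho Y w -> ortho (f Y) (L w)).
Proof.
move=> bT GY iYT; pose S := Y `&` T; have [GT _] := bT.
have sY := Ginf_subsp GY.
have SY : S `<=` Y by move=> ? [].
have ST : S `<=` T by move=> ? [].
have GS : G S.
  apply: (Ginf_sub hH GT _ iYT ST); apply: closedI; exact: Ginf_closed.
have sS := Ginf_subsp GS.
(* If [Y] exceeds [S] by at most one dimension, [f Y] is known outright; otherwise the swapped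
   alternative below can be refuted. *)
have [[y0 [Yy0 YS]]|far] := pselect (exists y0, Y y0 /\ Y `<=` addl S y0).
  have YE : Y = addl S y0 by apply/seteqP; split=> //; apply: addl_min.
  have fY : f Y = L @` Y by rewrite {1}YE [in RHS]YE; case: bT => _; apply.
  rewrite fY; split=> [y Yy|w Yw _ [y Yy <-]]; first by exists y.
  by rewrite Lip Yw ?sg0.
have LY y : Y y -> f Y (L y).
  move=> Yy; have GZ := Ginf_addl hH y GS.
  have sub : addl S y `<=` Y by apply: addl_min.
  apply: (rigid_mono hH fG f_pairs (subspT H) Li (@subsetT _ _) GZ GY _ sub).
    exact: base_rigid bT GS ST.
  by case: bT => _ ->  //; exists y => //; apply: addl_v.
split=> // w Yw; have [->|nw] := pselect (w = 0).
  by rewrite (siso0 (subspT H) Li) => x _; apply: ip0r.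
have GZ := Ginf_addl hH w GS.
have fZ : f (addl S w) = addl (L @` S) (L w).
  by case: bT => _ -> //; rewrite (image_addl (subspT H) Li).
have [M [Mi hM]] := f_pairsP hH f_pairs GZ GY; have [MD MZ Mip] := Mi.
(* The image of [S] lies in both [f (addl S w)] and [f Y], while [addl S w] meets [Y] only in [S]
   because [w] is orthogonal to [Y]. *)
have LSM : L @` S `<=` M @` S.
  move=> _ [s Ss <-].
  have h1 : f (addl S w) (L s) by rewrite fZ; apply: addl_sub; exists s.
  have h2 : f Y (L s) by apply: LY; apply: SY.
  have [x [y [Zx Yy xs ys]]] : exists x y, [/\ addl S w x, Y y, M x = L s & M y = L s].
    case: hM h1 h2 => -[-> ->] [x Zx xs] [y Yy ys]; first by exists x, y.
    by exists y, x.
  have xy : x = y by apply: (siso_inj hip (subspT H) Mi) => //; rewrite xs ys.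
  exists x => //; move: Zx => [a [t [St xE]]].
  suff e : a *: w = 0 by rewrite xE e addr0.
  have aE : a *: w = x - t by rewrite xE addrC addKr.
  apply: (ortho_self hH (X := Y)); first rewrite aE.
    by apply: subspB => //; [rewrite xy|apply: SY].
  by apply: (subspZ _ (proj1 (ortho_closed hH Y))).
(* Swapped alternative: every vector of [Y] would lie in [S] plus one line, contrary to [far]. *)
case: hM => -[hZ hY]; last first.
  case: far.
  have [y0 Yy0 y0E] : (M @` Y) (L w).
    rewrite -hZ fZ; apply: addl_v; exact: image_subsp.
  exists y0; split=> // y Yy.
  have : f (addl S w) (M y) by rewrite hZ; exists y.
  rewrite fZ => -[a [_ [/LSM[s Ss <-] e]]]; exists a, s; split=> //.
  by apply: (siso_inj hip (subspT H) Mi) => //; rewrite e MD // MZ // y0E.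
have [a ME] : exists a, M w = a *: L w.
  apply: (addl_ortho hH (image_subsp sS)).
  - by move=> p /LSM[s Ss <-]; rewrite Mip // Yw //; apply: SY.
  - by move=> _ [s Ss <-]; rewrite Lip Yw ?sg0 //; apply: SY.
  - by rewrite -fZ hZ; exists w => //; apply: addl_v.
have nM : M w <> 0.
  move=> e; apply: nw; apply: (ip_eq0 hip); have := Mip w w I I.
  by rewrite e (ip0l hip) /=.
rewrite (prop_sym nM ME) hY => _ [y Yy <-].
by rewrite (ipZr hip) Mip // Yw // mulr0.
Qed.

Hypothesis sepH : hseparable ip.

Lemma base_transfer T Y : base T -> G Y -> idim ip (Y `&` T) ->
  idim ip (ortho Y `&` T) -> f Y = L @` Y.
Proof.
move=> bT GY iYT iYT'; have cY := Ginf_closed GY; have sY := Ginf_subsp GY.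
have [sO _] := ortho_closed hH Y; have [GT _] := bT; have sT := Ginf_subsp GT.
have [y [Yy Ty yo ytot]] := orthonormal_basis sepH cY (Ginf_idim hH GY) iYT.
have [u [uYT uo]] := @idim_orthonormal _ _ _ hH (fun=> ortho Y `&` T) (fun=> iYT').
have Yu n : ortho Y (u n) by case: (uYT n).
have Tu n : T (u n) by case: (uYT n).
have yu n m : ip (y n) (u m) = 0 by apply: Yu.
have uy n m : ip (u m) (y n) = 0 by apply: (ipC0 hip).
(* Distinct positive weights make the values [1 + t n * t n], hence the eigenvalues, pairwise
   distinct. *)
pose t (n : nat) : C := n.+1%:R.
have tC n : (t n)^* = t n by rewrite conjC_nat.
have t0 n : 0 < t n by rewrite ltr0n.
pose N n : C := 1 + t n * t n.
have N0 n : N n != 0 by rewrite gt_eqF // addr_gt0 // mulr_gt0.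
have NC n : (N n)^* = N n by rewrite conjD conjM tC conjC1.
pose z n := y n + t n *: u n.
have zo n m : ip (z n) (z m) = (n == m)%:R * N n.
  rewrite /z !(ipE hip) yo uo yu uy tC; case: eqP => [->|_] /=; rewrite /N; ring.
have zy n m : ip (z n) (y m) = (n == m)%:R.
  by rewrite /z !(ipE hip) yo uy mulr0 addr0.
pose Y2 := clspan ip [set z n | n in setT].
have cY2 : closed_subspace ip Y2 := clspan_closed hH _.
have [sY2 _] := cY2.
have Y2z n : Y2 (z n) by apply: (clspan_sub hH); exists n.
have iY2 : idim ip (Y2 `&` T).
  apply: (@orthogonal_idim _ _ _ hH _ (fun n => z n.*2)) => [|n|n|n m nm].
  - by case: (closedI cY2 (Ginf_closed GT)).
  - by split=> //; apply: subspD => //; apply: subspZ.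
  - by rewrite zo eqxx mul1r.
  - by rewrite zo (_ : (_ == _) = false) ?mul0r //; apply/eqP; lia.
have GY2 : G Y2.
  apply/(GinfP hH); split=> //; first by apply: idim_sub iY2 => ? [].
  (* These vectors are orthogonal to all [z n] and witness the infinite codimension of [Y2]. *)
  apply: (@orthogonal_idim _ _ _ hH _ (fun n => t n *: y n - u n)) => [|n|n|n m nm].
  - by case: (ortho_closed hH Y2).
  - apply: (ortho_clspan hH) => _ [m _ <-].
    rewrite /z !(ipE hip) yo uo yu uy tC; case: eqP => [->|_] /=; ring.
  - suff -> : ip (t n *: y n - u n) (t n *: y n - u n) = N n by [].
    rewrite !(ipE hip) yo uo yu uy tC eqxx /N /=; ring.
  - rewrite !(ipE hip) yo uo yu uy tC (_ : (n == m) = false); last exact/eqP.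
    by rewrite /=; ring.
have [LY LYo] := base_bounds bT GY iYT; have [LY2 LY2o] := base_bounds bT GY2 iY2.
(* The projection of [y n] to [Y2] is [a n *: z n], with remainder [q n]; that of [z n] to [Y] is
   [y n], with remainder [r n]. So [a n] is the eigenvalue at [y n]. *)
pose a n : C := (N n)^-1.
have aC n : (a n)^* = a n by rewrite conjV NC.
have aN n : a n * N n = 1 by rewrite mulVf.
have a_inj n k : a n = a k -> n = k.
  move=> /invr_inj/addrI; rewrite /t -!natrM => /eqP; rewrite eqr_nat => /eqP; nia.
pose q n := y n - a n *: z n.
have Y2q n : ortho Y2 (q n).
  apply: (ortho_clspan hH) => _ [m _ <-].
  rewrite /q (ipBr hip) (ipZr hip) zy zo aC; case: eqP => [->|_].
    by rewrite mul1r aN subrr.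
  by rewrite mul0r mulr0 subrr.
pose r n := t n *: u n.
have Yr n : ortho Y (r n) by apply: (subspZ _ sO).
have yE n : y n = a n *: z n + q n by rewrite addrC subrK.
have zE n : z n = y n + r n by [].
clearbody q r.
have LyE n : L (y n) = a n *: L (z n) + L (q n) by rewrite {1}yE LD LZ sg_real.
have LzE n : L (z n) = L (y n) + L (r n) by rewrite zE LD.
(* [P_Y P_Y2] has the simple eigenvalues [a n] on Y; L and M both intertwine it
   with [P_(f Y) P_(f Y2)], so [L (y n)] is orthogonal to the images under M of
   the other eigenvectors. *)
have [M [Mi hM]] := f_pairsP hH f_pairs GY GY2; have [MD MZ Mip] := Mi.
have MyE n : M (y n) = a n *: M (z n) + M (q n) by rewrite {1}yE MD // MZ.
have MzE n : M (z n) = M (y n) + M (r n) by rewrite zE MD.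
have Mo X x : ortho X x -> ortho (M @` X) (M x) by move=> Xx _ [w Xw <-]; rewrite Mip // Xx.
have LYsub : L @` Y `<=` f Y by move=> _ [x Yx <-]; apply: LY.
have cLY : closed_subspace ip (L @` Y) by apply: (image_closed hH (subspT H) Li).
have y1 n : y n <> 0 by apply: (unit_neq0 hip); rewrite yo eqxx.
apply/seteqP; split=> //.
case: hM => -[fY fY2].
  have fYM n : f Y (M (y n)) by rewrite fY; exists (y n).
  have fY2M n : f Y2 (M (z n)) by rewrite fY2; exists (z n).
  have fYq n : ortho (f Y) (M (r n)) by rewrite fY; apply: Mo.
  have fY2q n : ortho (f Y2) (M (q n)) by rewrite fY2; apply: Mo.
  apply: (@sub_of_orthogonal_total _ _ (L \o y) (M \o y)) => //=.
  - exact: Ginf_subsp (fG GY).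
  - by move=> n; exists (y n).
  - by move=> n; apply: L_neq0.
  - by move=> n m nm; rewrite Mip //= yo; case: eqP.
  - by move=> n; rewrite Mip //= yo eqxx oner_eq0.
  - move=> w; rewrite fY => -[x Yx <-] h; rewrite (ytot x) //.
      exact: (siso0 (subspT H) Mi).
    by move=> n; have := h n; rewrite Mip.
  move=> n k nk.
  (* [E1] to [E4] evaluate [ip (L (y n)) (M (y k))] as both [a n] and [a k] times
     [ip (L (z n)) (M (z k))]. *)
  have E1 : ip (L (y n)) (M (z k)) = a n * ip (L (z n)) (M (z k)).
    by rewrite LyE (ipDl hip) (ipZl hip) (ipC0 hip (LY2o _ (Y2q n) _ _)) ?addr0.
  have E2 : ip (L (z n)) (M (y k)) = ip (L (y n)) (M (y k)).
    by rewrite LzE (ipDl hip) (ipC0 hip (LYo _ (Yr n) _ _)) ?addr0.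
  have E3 : ip (L (y n)) (M (z k)) = ip (L (y n)) (M (y k)).
    by rewrite MzE (ipDr hip) (fYq k (L (y n))) ?addr0 //; apply: LY.
  have E4 : ip (L (z n)) (M (y k)) = a k * ip (L (z n)) (M (z k)).
    by rewrite MyE (ipDr hip) (ipZr hip) aC (fY2q k (L (z n))) ?addr0 //; apply: LY2.
  have : (a n - a k) * ip (L (z n)) (M (z k)) = 0.
    by rewrite mulrBl -E1 -E4 E3 E2 subrr.
  move=> /eqP; rewrite mulf_eq0 subr_eq0 => /orP[/eqP/a_inj //|/eqP e].
  by rewrite -E3 E1 e mulr0.
(* Swapped alternative: [f Y] is now the image of [Y2], whose total family [z n] consists of
   eigenvectors for the composition in the other order, with the same eigenvalues. *)
have fYM n : f Y (M (z n)) by rewrite fY; exists (z n).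
have fY2M n : f Y2 (M (y n)) by rewrite fY2; exists (y n).
have fYq n : ortho (f Y) (M (q n)) by rewrite fY; apply: Mo.
have fY2q n : ortho (f Y2) (M (r n)) by rewrite fY2; apply: Mo.
apply: (@sub_of_orthogonal_total _ _ (L \o y) (M \o z)) => //=.
- exact: Ginf_subsp (fG GY).
- by move=> n; exists (y n).
- by move=> n; apply: L_neq0.
- by move=> n m nm; rewrite Mip //= zo; case: eqP => //; rewrite mul0r.
- by move=> n; rewrite Mip //= zo eqxx mul1r.
- move=> w; rewrite fY => -[x Y2x <-] h.
  suff -> : x = 0 by exact: (siso0 (subspT H) Mi).
  apply: (ip_eq0 hip); apply: Y2x => _ [n _ <-].
  by have := h n; rewrite Mip.
move=> n k nk.
have E1 : ip (L (y n)) (M (y k)) = a n * ip (L (z n)) (M (y k)).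
  by rewrite LyE (ipDl hip) (ipZl hip) (ipC0 hip (LY2o _ (Y2q n) _ _)) ?addr0.
have E2 : ip (L (z n)) (M (z k)) = ip (L (y n)) (M (z k)).
  by rewrite LzE (ipDl hip) (ipC0 hip (LYo _ (Yr n) _ _)) ?addr0.
have E3 : ip (L (y n)) (M (y k)) = a k * ip (L (y n)) (M (z k)).
  by rewrite MyE (ipDr hip) (ipZr hip) aC (fYq k (L (y n))) ?addr0 //; apply: LY.
have E4 : ip (L (z n)) (M (z k)) = ip (L (z n)) (M (y k)).
  by rewrite MzE (ipDr hip) (fY2q k (L (z n))) ?addr0 //; apply: LY2.
have : (a n - a k) * ip (L (y n)) (M (z k)) = 0.
  by rewrite mulrBl -E3 E1 -E2 E4 subrr.
by move=> /eqP; rewrite mulf_eq0 subr_eq0 => /orP[/eqP/a_inj //|/eqP e].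
Qed.

(** The extension [X] of [T1] and all its hyperplanes keep infinite overlap with [T], as do their
    complements. [base_transfer] then gives the values of [f] on them, and rigidity below [X]
    follows. *)
Lemma base_of_overlap T T1 : base T -> G T1 -> idim ip (T1 `&` T) ->
  idim ip (ortho T1 `&` T) -> base T1.
Proof.
move=> bT GT1 iT iT'; split=> // T' GT' T'T1 v.
pose X := addl T1 v; have GX : G X := Ginf_addl hH v GT1.
have cX := Ginf_closed GX.
have iX : idim ip (X `&` T).
  by apply: idim_sub iT => x [Tx T1x]; split=> //; apply: addl_sub.
have iX' : idim ip (ortho X `&` T).
  apply: idim_sub (idim_perp hH v iT') => x [[T1x Tx] vx]; split=> // _ [a [t [T1t ->]]].
  by rewrite (ipDl hip) (ipZl hip) T1x // vx mulr0 addr0.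
have fX : f X = L @` X := base_transfer bT GX iX iX'.
have fZ x : f (perp ip X x) = L @` perp ip X x.
  apply: (base_transfer bT (Ginf_perp hH x GX)).
    by apply: idim_sub (idim_perp hH x iX) => w [[Xw Tw] xw].
  apply: idim_sub iX' => w [Xw Tw]; split=> //; apply: ortho_anti Xw; exact: perp_sub.
have cfX := Ginf_closed (fG GX).
have rX : rigid ip f L X.
  apply: (rigid_of_hyperplanes hH fG f_pairs (subspT H) Li) => //.
    apply/seteqP; split=> [_ [_ /(hyperplanesP hH _ cX)[x [Xx nx ->]] <-]|Z'].
      rewrite fZ (image_perp Li) // -fX; apply: (hyperplane_perp hH cfX).
        by rewrite fX; exists x.
      exact: L_neq0.
    move=> /(hyperplanesP hH _ cfX)[p []]; rewrite {1}fX => -[x Xx <-] nx ->.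
    exists (perp ip X x); last by rewrite fZ (image_perp Li) // -fX.
    apply: (hyperplane_perp hH cX) => // x0; apply: nx.
    by rewrite x0 (siso0 (subspT H) Li).
  by move=> Z /(hyperplanesP hH _ cX)[x [_ _ ->]].
by apply: rX; [exact: Ginf_addl|exact: addl_mono].
Qed.

Lemma base_global T Y : base T -> G Y -> f Y = L @` Y.
Proof.
move=> bT GY; have [GT _] := bT.
have iT := Ginf_idim hH GT; have [_ iY iY'] := (GinfP hH Y).1 GY.
(* Residues modulo 4 interleave four demands: classes 0 and 1 lie in [T], class 2 in [Y], class 3 in
   its complement. [T1] is spanned by all classes but 1, which remains orthogonal to it. *)
pose X (n : nat) := if (n %% 4 < 2)%N then T else if (n %% 4 == 2)%N then Y else ortho Y.
have [|e [eX eo]] := @idim_orthonormal _ _ _ hH X.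
  by move=> n; rewrite /X; case: ifP => // _; case: ifP.
pose T1 := clspan ip [set e n | n in [set n | (n %% 4 != 1)%N]].
have cT1 : closed_subspace ip T1 := clspan_closed hH _.
have T1e n : (n %% 4 != 1)%N -> T1 (e n) by move=> n1; apply: (clspan_sub hH); exists n.
have T1e' n : (n %% 4 = 1)%N -> ortho T1 (e n).
  move=> n1; apply: (ortho_clspan hH) => _ [m /= m1 <-]; rewrite eo.
  by case: eqP => // mn; rewrite mn n1 in m1.
have sub A c : closed_subspace ip A -> (forall k, A (e (k * 4 + c)%N)) -> idim ip A.
  move=> [sA _] Ae; apply: (subsequence_idim hH sA eo _ Ae) => n m; lia.
have cO : closed_subspace ip (ortho T1) := ortho_closed hH T1.
have cO' : closed_subspace ip (ortho Y) := ortho_closed hH Y.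
have cT := Ginf_closed GT; have cY := Ginf_closed GY.
have m4 k c : (c < 4)%N -> ((k * 4 + c) %% 4 = c)%N by move=> c4; rewrite modnMDl modn_small.
have eT k c : (c < 2)%N -> T (e (k * 4 + c)%N).
  by move=> c2; have := eX (k * 4 + c)%N; rewrite /X m4 ?c2 //; apply: leq_trans c2 _.
have i0 : idim ip (T1 `&` T).
  apply: (sub _ 0%N); first exact: closedI.
  by move=> k; split; [apply: T1e; rewrite m4|apply: eT].
have i1 : idim ip (ortho T1 `&` T).
  apply: (sub _ 1%N); first exact: closedI.
  by move=> k; split; [apply: T1e'; rewrite m4|apply: eT].
have i2 : idim ip (Y `&` T1).
  apply: (sub _ 2%N); first exact: closedI.
  move=> k; split; last by apply: T1e; rewrite m4.
  by have := eX (k * 4 + 2)%N; rewrite /X m4.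
have i3 : idim ip (ortho Y `&` T1).
  apply: (sub _ 3%N); first exact: closedI.
  move=> k; split; last by apply: T1e; rewrite m4.
  by have := eX (k * 4 + 3)%N; rewrite /X m4.
have GT1 : G T1.
  apply/(GinfP hH); split=> //; first by apply: idim_sub i0 => ? [].
  by apply: idim_sub i1 => ? [].
exact: base_transfer (base_of_overlap bT GT1 i0 i1) GY i2 i3.
Qed.

End Propagation.

Theorem theorem2 (R : realType) (H : lmodType R[i]) (ip : H -> H -> R[i])
  (hH : hilbert_space ip) (sepH : hseparable ip) (infH : infinite_dim [set: H])
  (f : set H -> set H)
  (f_Ginf : forall X, Ginf ip X -> Ginf ip (f X))
  (f_pairs : forall X Y, Ginf ip X -> Ginf ip Y -> equiv_pairs ip X Y (f X) (f Y))
  (X0 : set H) (X0_Ginf : Ginf ip X0)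
  (f_hyp : f @` hyperplanes ip X0 = hyperplanes ip (f X0)) :
  exists L : H -> H, (lin_isometry ip L \/ conjlin_isometry ip L) /\
    forall Y, Ginf ip Y -> f Y = L @` Y.
Proof.
have [b [U [Ui _ Urigid]]] := rigid_base hH f_Ginf f_pairs X0_Ginf f_hyp.
have [L [T [Li bT]]] := base_exists hH f_Ginf f_pairs X0_Ginf Ui Urigid.
exists L; split; first exact: siso_isometry Li.
by move=> Y GY; apply: (base_global hH f_Ginf f_pairs Li sepH bT GY).
Qed.
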